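(* Let $M_1\times_f M_2$ be a warped product manifold with metric $g$, and let $\zeta=(\zeta_1,\zeta_2)=\zeta_1+\zeta_2\in\mathfrak{X}(M_1\times_f M_2)$ be a vector field with $\zeta_i\in\mathfrak{X}(M_i)$, $i=1,2$. Then $$ \begin{aligned} (\mathcal{L}_{\zeta}\mathcal{L}_{\zeta}g)(X,Y)={}&(\mathcal{L}^1_{\zeta_1}\mathcal{L}^1_{\zeta_1}g_1)(X_1,Y_1)+f^2(\mathcal{L}^2_{\zeta_2}\mathcal{L}^2_{\zeta_2}g_2)(X_2,Y_2)\\ &+4f\zeta_1(f)(\mathcal{L}^2_{\zeta_2}g_2)(X_2,Y_2)+2f\zeta_1(\zeta_1(f))\,g_2(X_2,Y_2)\\ &+2\zeta_1(f)\zeta_1(f)\,g_2(X_2,Y_2) \end{aligned} $$ for any vector fields $X,Y\in\mathfrak{X}(M_1\times_f M_2)$.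
   Context: Let $(M_1,g_1)$ and $(M_2,g_2)$ be smooth pseudo-Riemannian manifolds and $f:M_1\to(0,\infty)$ a smooth function. The warped product $M_1\times_f M_2$ is the product manifold $M_1\times M_2$ with the metric $g=\pi_1^*(g_1)\oplus(f\circ\pi_1)^2\pi_2^*(g_2)$, where $\pi_i:M_1\times M_2\to M_i$ are the natural projections. $\mathfrak{X}(M)$ denotes the smooth vector fields on $M$. The same notation is used for a vector field on a factor $M_i$ and for its lift to the product (and for $f$ and $f\circ\pi_1$); $\zeta=(\zeta_1,\zeta_2)=\zeta_1+\zeta_2$ means the sum of the lifts of $\zeta_i\in\mathfrak{X}(M_i)$. For vector fields $X,Y$ on the product, $X_i,Y_i$ denote the components tangent to $M_i$ (all terms of the identity are tensorial in $X,Y$ and are evaluated pointwise). $\mathcal{L}_\zeta$ is the Lie derivative on $M_1\times_f M_2$ with respect to $\zeta$, and $\mathcal{L}^i_{\zeta_i}$ is the Lie derivative on $M_i$ with respect to $\zeta_i$. $\zeta_1(f)$ is the derivative of $f$ in the direction $\zeta_1$. *)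

(* Defs.v *)
From HB Require Import structures.
From mathcomp Require Import all_boot all_order all_algebra.
From mathcomp Require Import all_classical all_reals all_analysis.
Set Implicit Arguments.
Unset Strict Implicit.
Unset Printing Implicit Defensive.
Import Order.TTheory GRing.Theory Num.Theory.
Import numFieldNormedType.Exports.
Local Open Scope classical_set_scope.
Local Open Scope ring_scope.

(* C^k and C^oo maps on an open set U.  For finite-dimensional V, the map
   x |-> 'd f x is C^k iff each x |-> 'D_v f x is. *)
Fixpoint Ck (R : realType) (k : nat) (V W : normedModType R) (U : set V)
    (f : V -> W) : Prop :=
  match k with
  | 0%N => forall x, U x -> {for x, continuous f}
  | k'.+1 => (forall x, U x -> differentiable f x) /\
             forall v, Ck k' U ('D_v f)
  end.

Definition smooth_on (R : realType) (V W : normedModType R) (U : set V)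
    (f : V -> W) : Prop :=
  forall k, Ck k U f.

(* chart_inv is only meaningful on the image of the chart domain. *)
Record chart (R : realType) (T : topologicalType) (n : nat) := Chart {
  chart_dom : set T;
  chart_coord :> T -> 'rV[R]_n;
  chart_inv : 'rV[R]_n -> T;
  chart_dom_open : open chart_dom;
  chart_img_open : open (chart_coord @` chart_dom);
  chart_coordK : forall p, chart_dom p -> chart_inv (chart_coord p) = p;
  chart_coord_continuous :
    forall p, chart_dom p -> {for p, continuous chart_coord};
  chart_inv_continuous :
    forall x, (chart_coord @` chart_dom) x -> {for x, continuous chart_inv}
}.

(* Each point comes with a preferred chart.  A tangent vector at p is represented
   by its row of components in the preferred chart at p, and a bilinear form on
   the tangent space at p by its Gram matrix in the same basis.  Thus
   M -> 'rV_(dim M) is the type of (rough) vector fields and M -> 'M_(dim M)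
   that of (rough) covariant 2-tensor fields. *)
Record manifold (R : realType) := Manifold {
  space :> topologicalType;
  dim : nat;
  atlas : set (chart R space dim);
  chart_at : space -> chart R space dim;
  chart_at_atlas : forall p, atlas (chart_at p);
  chart_at_dom : forall p, chart_dom (chart_at p) p;
  atlas_compat : forall c d, atlas c -> atlas d ->
    smooth_on (c @` (chart_dom c `&` chart_dom d)) (d \o chart_inv c);
  manifold_hausdorff : hausdorff_space space;
  manifold_second_countable : @second_countable space
}.

Section Manifold.
Context {R : realType}.
Implicit Types M N : manifold R.

(* Matrix of the differential of F at p, acting on rows on the right:
   u |-> u *m dmap F p. *)
Definition dmap M N (F : M -> N) (p : M) : 'M[R]_(dim M, dim N) :=
  'J (chart_at (F p) \o F \o chart_inv (chart_at p)) (chart_at p p).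

(* Jacobian at p of the change of coordinates from c to d. *)
Definition cjac M (c d : chart R M (dim M)) (p : M) : 'M[R]_(dim M) :=
  'J (d \o chart_inv c) (c p).

(* Components in the chart c of a vector field X. *)
Definition components M (c : chart R M (dim M)) (X : M -> 'rV[R]_(dim M))
    (p : M) : 'rV[R]_(dim M) :=
  X p *m cjac (chart_at p) c p.

(* The coordinate field d/dx^i of c; meaningful on chart_dom c only. *)
Definition frame M (c : chart R M (dim M)) (i : 'I_(dim M)) (p : M)
    : 'rV[R]_(dim M) :=
  row i (cjac c (chart_at p) p).

Definition bval n (A : 'M[R]_n) (u v : 'rV[R]_n) : R := (u *m A *m v^T) 0 0.

Definition teval M (T : M -> 'M[R]_(dim M)) (X Y : M -> 'rV[R]_(dim M))
    : M -> R :=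
  fun p => bval (T p) (X p) (Y p).

Definition smooth_fun M (f : M -> R) : Prop :=
  forall c, atlas c ->
    smooth_on (c @` chart_dom c) (f \o chart_inv c : _ -> R^o).

Definition smooth_vfield M (X : M -> 'rV[R]_(dim M)) : Prop :=
  forall c, atlas c ->
    smooth_on (c @` chart_dom c) (components c X \o chart_inv c).

Definition smooth_tensor M (T : M -> 'M[R]_(dim M)) : Prop :=
  forall c, atlas c -> forall i j,
    smooth_on (c @` chart_dom c)
      (teval T (frame c i) (frame c j) \o chart_inv c : _ -> R^o).

Record vfield M := VField {
  vfield_fun :> M -> 'rV[R]_(dim M);
  vfield_smooth : smooth_vfield vfield_fun
}.

Record metric M := Metric {
  metric_fun :> M -> 'M[R]_(dim M);
  metric_smooth : smooth_tensor metric_fun;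
  metric_sym : forall p, (metric_fun p)^T = metric_fun p;
  metric_nondeg : forall p, metric_fun p \in unitmx
}.

(* X(f), the derivative of f in the direction X. *)
Definition vderiv M (X : M -> 'rV[R]_(dim M)) (f : M -> R) (p : M) : R :=
  'D_(X p) (f \o chart_inv (chart_at p) : _ -> R^o) (chart_at p p).

(* [X, Y] = (X^i d_i Y^j - Y^i d_i X^j) d_j, in the preferred chart. *)
Definition lie_bracket M (X Y : M -> 'rV[R]_(dim M)) (p : M)
    : 'rV[R]_(dim M) :=
  let c := chart_at p in
  'D_(X p) (components c Y \o chart_inv c) (c p)
  - 'D_(Y p) (components c X \o chart_inv c) (c p).

(* (L_X T)(U, V) = X(T(U, V)) - T([X, U], V) - T(U, [X, V]).  The right-hand side
   at p depends on U and V only through U p and V p, so it is evaluated on the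
   local fields U = d_i, V = d_j extending the basis vectors at p. *)
Definition lie_derivative M (X : M -> 'rV[R]_(dim M))
    (T : M -> 'M[R]_(dim M)) (p : M) : 'M[R]_(dim M) :=
  \matrix_(i, j)
    let U := frame (chart_at p) i in
    let V := frame (chart_at p) j in
    vderiv X (teval T U V) p
    - teval T (lie_bracket X U) V p - teval T U (lie_bracket X V) p.

Definition pullback M N (F : M -> N) (T : N -> 'M[R]_(dim N)) (p : M)
    : 'M[R]_(dim M) :=
  dmap F p *m T (F p) *m (dmap F p)^T.

End Manifold.

Section SmoothRow.
Context {R : realType}.

Lemma near_differentiable (V W : normedModType R) (f g : V -> W) (x : V) :
  {near x, f =1 g} -> differentiable f x -> differentiable g x.
Proof.
move=> fg df; have gx : f x = g x := nbhs_singleton fg.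
have dc : continuous ('d f x) by exact: diff_continuous.
have gl : g \o shift x = cst (g x) + 'd f x +o_ 0 id.
  apply/eqaddoP => _/posnumP[e].
  have fs : \forall h \near 0, f (h + x) = g (h + x).
    by move: fg; rewrite [X in X -> _](near_shift 0) subr0.
  have /eqaddoP/(_ _ (gt0 e)) := diff_locally df.
  apply: filterS2 fs => h.
  by rewrite !fctE /= => ->; rewrite gx.
apply/diff_locallyP; split; first by rewrite (diff_unique dc gl).
by rewrite (diff_unique dc gl).
Qed.

Lemma Ck_eq k (V W : normedModType R) (U : set V) (f g : V -> W) : open U ->
  (forall x, U x -> f x = g x) -> Ck k U f -> Ck k U g.
Proof.
move=> oU; elim: k f g => [|k IH] f g fg /=.
  move=> cf x Ux; rewrite /prop_for /continuous_at -(fg _ Ux).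
  apply: cvg_trans (cf x Ux); apply: near_eq_cvg.
  by apply: filterS (open_nbhs_nbhs (conj oU Ux)) => y /fg.
have fgn x : U x -> {near x, f =1 g}.
  by move=> Ux; apply: filterS (open_nbhs_nbhs (conj oU Ux)) => y /fg.
move=> [df Df]; split=> [x Ux|v].
  exact: near_differentiable (fgn _ Ux) (df _ Ux).
by apply: IH (Df v) => x Ux; apply: near_eq_derive; exact: fgn.
Qed.

Lemma cvg_row_mx (T : Type) (F : set_system T) {FF : Filter F} n1 n2
    (f : T -> 'rV[R]_n1) (g : T -> 'rV[R]_n2)
    (a : 'rV[R]_n1) (b : 'rV[R]_n2) :
  f @ F --> a -> g @ F --> b ->
  (fun x => row_mx (f x) (g x)) @ F --> row_mx a b.
Proof.
move=> /cvg_ballP fa /cvg_ballP gb; apply/cvg_ballP => e e0.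
near=> x.
have [_ fx] : ball a e (f x) by near: x; exact: fa.
have [_ gx] : ball b e (g x) by near: x; exact: gb.
split=> // i j; rewrite !mxE; case: (fintype.split j) => k; [exact: fx|exact: gx].
Unshelve. all: by end_near. Qed.

Lemma continuous_row_mx (T : topologicalType) n1 n2
    (f : T -> 'rV[R]_n1) (g : T -> 'rV[R]_n2) (x : T) :
  {for x, continuous f} -> {for x, continuous g} ->
  {for x, continuous (fun y => row_mx (f y) (g y))}.
Proof. by move=> cf cg; exact: (@cvg_row_mx _ (nbhs x) _). Qed.

Definition rowl n1 n2 (a : 'rV[R]_n1) : 'rV[R]_(n1 + n2) := row_mx a 0.
Definition rowr n1 n2 (b : 'rV[R]_n2) : 'rV[R]_(n1 + n2) := row_mx 0 b.

Fact rowl_linear n1 n2 : linear (@rowl n1 n2).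
Proof.
by move=> k u v; rewrite /rowl scale_row_mx add_row_mx scaler0 addr0.
Qed.
Fact rowr_linear n1 n2 : linear (@rowr n1 n2).
Proof.
by move=> k u v; rewrite /rowr scale_row_mx add_row_mx scaler0 addr0.
Qed.
HB.instance Definition _ n1 n2 := GRing.isLinear.Build R _ _ _ (@rowl n1 n2)
  (@rowl_linear n1 n2).
HB.instance Definition _ n1 n2 := GRing.isLinear.Build R _ _ _ (@rowr n1 n2)
  (@rowr_linear n1 n2).

Lemma rowl_continuous n1 n2 : continuous (@rowl n1 n2).
Proof.
by move=> x; apply: (@continuous_row_mx _ _ _ id (cst 0));
  [exact: cvg_id|exact: cst_continuous].
Qed.
Lemma rowr_continuous n1 n2 : continuous (@rowr n1 n2).
Proof.
by move=> x; apply: (@continuous_row_mx _ _ _ (cst 0) id);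
  [exact: cst_continuous|exact: cvg_id].
Qed.

Section RowMap.
Variables (n1 n2 m1 m2 : nat).
Implicit Types (f : 'rV[R]_n1 -> 'rV[R]_m1) (g : 'rV[R]_n2 -> 'rV[R]_m2).

Definition row_map f g (x : 'rV[R]_(n1 + n2)) : 'rV[R]_(m1 + m2) :=
  row_mx (f (lsubmx x)) (g (rsubmx x)).

Lemma row_mapE f g :
  row_map f g = (@rowl m1 m2 \o (f \o lsubmx)) + (@rowr m1 m2 \o (g \o rsubmx)).
Proof.
by apply/funext => x; rewrite fctE /= /rowl /rowr add_row_mx addr0 add0r.
Qed.

Lemma row_map_diff f g x : differentiable f (lsubmx x) ->
  differentiable g (rsubmx x) ->
  differentiable (row_map f g) x /\
  forall v, 'D_v (row_map f g) x =
    row_mx ('D_(lsubmx v) f (lsubmx x)) ('D_(rsubmx v) g (rsubmx x)).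
Proof.
move=> df dg.
have dl := differentiable_lsubmx x; have dr := differentiable_rsubmx x.
have dfl : differentiable (f \o lsubmx) x by exact: differentiable_comp.
have dgr : differentiable (g \o rsubmx) x by exact: differentiable_comp.
have di y : differentiable (@rowl m1 m2) y.
  exact/linear_differentiable/rowl_continuous.
have dj y : differentiable (@rowr m1 m2) y.
  exact/linear_differentiable/rowr_continuous.
have d1 : differentiable (@rowl m1 m2 \o (f \o lsubmx)) x.
  exact: differentiable_comp.
have d2 : differentiable (@rowr m1 m2 \o (g \o rsubmx)) x.
  exact: differentiable_comp.
have d : differentiable (row_map f g) x.
  by rewrite row_mapE; exact: differentiableD.
have e1 : 'd (@rowl m1 m2 \o (f \o lsubmx)) x =
    @rowl m1 m2 \o ('d f (lsubmx x) \o lsubmx) :> (_ -> _).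
  have -> := diff_comp dfl (di _).
  have -> := diff_comp dl df.
  have -> := diff_lin (f (lsubmx x)) (@rowl_continuous m1 m2).
  by have -> := diff_lin x (@continuous_lsubmx R 1 n1 n2).
have e2 : 'd (@rowr m1 m2 \o (g \o rsubmx)) x =
    @rowr m1 m2 \o ('d g (rsubmx x) \o rsubmx) :> (_ -> _).
  have -> := diff_comp dgr (dj _).
  have -> := diff_comp dr dg.
  have -> := diff_lin (g (rsubmx x)) (@rowr_continuous m1 m2).
  by have -> := diff_lin x (@continuous_rsubmx R 1 n1 n2).
split=> // v; rewrite row_mapE.
have -> := deriveD (diff_derivable d1) (diff_derivable d2).
have -> := etrans (deriveE v d1) (congr1 (@^~ v) e1).
have -> := etrans (deriveE v d2) (congr1 (@^~ v) e2).
have -> := deriveE (lsubmx v) df; have -> := deriveE (rsubmx v) dg.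
by rewrite /= /rowl /rowr add_row_mx addr0 add0r.
Qed.

Definition row_set (U1 : set 'rV[R]_n1) (U2 : set 'rV[R]_n2) :
    set 'rV[R]_(n1 + n2) :=
  [set x | U1 (lsubmx x) /\ U2 (rsubmx x)].

Lemma row_set_open U1 U2 : open U1 -> open U2 -> open (row_set U1 U2).
Proof.
move=> o1 o2; apply: (@openI _ (lsubmx @^-1` U1) (rsubmx @^-1` U2)).
  by move/continuousP: (@continuous_lsubmx R 1 n1 n2); apply.
by move/continuousP: (@continuous_rsubmx R 1 n1 n2); apply.
Qed.
End RowMap.

Lemma row_map_Ck n1 n2 m1 m2 U1 U2 k (f : 'rV[R]_n1 -> 'rV[R]_m1)
    (g : 'rV[R]_n2 -> 'rV[R]_m2) : open U1 -> open U2 ->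
  Ck k U1 f -> Ck k U2 g -> Ck k (row_set U1 U2) (row_map f g).
Proof.
move=> o1 o2; elim: k f g => [|k IH] f g /= => [cf cg x [x1 x2]|].
  apply: (@continuous_row_mx _ _ _ (f \o lsubmx) (g \o rsubmx)).
    by apply: continuous_comp; [exact: continuous_lsubmx|exact: cf].
  by apply: continuous_comp; [exact: continuous_rsubmx|exact: cg].
move=> [df Df] [dg Dg]; split=> [x [x1 x2]|v].
  by case: (row_map_diff (df _ x1) (dg _ x2)).
apply: Ck_eq (IH _ _ (Df (lsubmx v)) (Dg (rsubmx v))).
  exact: row_set_open.
by move=> x [x1 x2]; case: (row_map_diff (df _ x1) (dg _ x2)) => _ ->.
Qed.

End SmoothRow.

Lemma chart_overlap_open (R : realType) (T : topologicalType) n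
    (c : chart R T n) (B : set T) : open B -> open (c @` (chart_dom c `&` B)).
Proof.
move=> oB; rewrite openE => _ [p [cp Bp] <-].
have icp : (c @` chart_dom c) (c p) by exists p.
have n1 : nbhs (c p) (c @` chart_dom c).
  by apply: open_nbhs_nbhs; split => //; exact: chart_img_open.
have n2 : nbhs (c p) (chart_inv c @^-1` B).
  apply: chart_inv_continuous => //; rewrite chart_coordK //.
  exact: open_nbhs_nbhs.
apply: filterS2 n1 n2 => x [q cq <-] /=; rewrite chart_coordK// => Bq.
by exists q.
Qed.

Lemma setX_open (T1 T2 : topologicalType) (A : set T1) (B : set T2) :
  open A -> open B -> open (A `*` B).
Proof.
move=> oA oB; rewrite openE => -[p q] [/= Ap Bq].
by exists (A, B) => //; split; exact: open_nbhs_nbhs.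
Qed.

Section Product.
Context {R : realType}.

Section ProdChart.
Variables (T1 T2 : topologicalType) (n1 n2 : nat).
Variables (c : chart R T1 n1) (d : chart R T2 n2).

Let dom : set (T1 * T2) := chart_dom c `*` chart_dom d.
Let coord (z : T1 * T2) : 'rV[R]_(n1 + n2) := row_mx (c z.1) (d z.2).
Let inv (x : 'rV[R]_(n1 + n2)) : T1 * T2 :=
  (chart_inv c (lsubmx x), chart_inv d (rsubmx x)).

Lemma prod_chart_img :
  coord @` dom = row_set (c @` chart_dom c) (d @` chart_dom d).
Proof.
apply/seteqP; split=> x /=.
  move=> [[p q] [/= cp dq] <-]; rewrite /row_set /coord /= row_mxKl row_mxKr.
  by split; [exists p|exists q].
move=> [[p cp px] [q dq qx]]; exists (p, q) => //.
by rewrite /coord /= px qx hsubmxK.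
Qed.

Fact prod_chart_dom_open : open dom.
Proof. by apply: setX_open; exact: chart_dom_open. Qed.

Fact prod_chart_img_open : open (coord @` dom).
Proof. by rewrite prod_chart_img; apply: row_set_open; exact: chart_img_open. Qed.

Fact prod_chart_coordK z : dom z -> inv (coord z) = z.
Proof.
by case: z => p q [/= cp dq]; rewrite /inv /coord row_mxKl row_mxKr !chart_coordK.
Qed.

Fact prod_chart_coord_continuous z : dom z -> {for z, continuous coord}.
Proof.
move=> [cp dq]; apply: (@continuous_row_mx _ _ _ _ (c \o fst) (d \o snd)).
  by apply: continuous_comp; [exact: cvg_fst|exact: chart_coord_continuous].
by apply: continuous_comp; [exact: cvg_snd|exact: chart_coord_continuous].
Qed.

Fact prod_chart_inv_continuous x : (coord @` dom) x -> {for x, continuous inv}.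
Proof.
rewrite prod_chart_img => -[cx dx].
have cl : {for x, continuous (chart_inv c \o lsubmx)}.
  by apply: continuous_comp; [exact: continuous_lsubmx|exact: chart_inv_continuous].
have cr : {for x, continuous (chart_inv d \o rsubmx)}.
  by apply: continuous_comp; [exact: continuous_rsubmx|exact: chart_inv_continuous].
exact: (cvg_pair cl cr).
Qed.

Definition prod_chart : chart R (T1 * T2)%type (n1 + n2) :=
  Chart prod_chart_dom_open prod_chart_img_open prod_chart_coordK
    prod_chart_coord_continuous prod_chart_inv_continuous.
End ProdChart.

Lemma hausdorff_prod (T1 T2 : topologicalType) : hausdorff_space T1 ->
  hausdorff_space T2 -> hausdorff_space (T1 * T2)%type.
Proof.
move=> h1 h2 [p q] [p' q'] cl; congr pair.
  apply: h1 => A B pA p'B; have [||[x y] [[Ax _] [Bx _]]] := cl (A `*` setT)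
    (B `*` setT).
  - by exists (A, setT) => //; split=> //; exact: filterT.
  - by exists (B, setT) => //; split=> //; exact: filterT.
  by exists x.
apply: h2 => A B pA p'B; have [||[x y] [[_ Ax] [_ Bx]]] := cl (setT `*` A)
  (setT `*` B).
- by exists (setT, A) => //; split=> //; exact: filterT.
- by exists (setT, B) => //; split=> //; exact: filterT.
by exists y.
Qed.

Lemma second_countable_prod (T1 T2 : topologicalType) :
  @second_countable T1 -> @second_countable T2 ->
  @second_countable (T1 * T2)%type.
Proof.
move=> [B1 cB1 [oB1 bB1]] [B2 cB2 [oB2 bB2]].
exists ((fun AB : set T1 * set T2 => AB.1 `*` AB.2) @` (B1 `*` B2)).
  exact: sub_countable (card_image_le _ _) (countableX cB1 cB2).
split=> [_ [[A B] [/= /oB1 oA /oB2 oB] <-]|[p q] S]; first exact: setX_open.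
move=> [[P Q] [/= /bB1[A [B1A Ap] AP] /bB2[B [B2B Bq] BQ]] PQS].
exists (A `*` B); first by split=> //; exists (A, B).
by move=> [x y] [/= /AP ? /BQ ?]; exact: PQS.
Qed.

Section ProdManifold.
Variables M1 M2 : manifold R.

Definition prod_atlas : set (chart R (M1 * M2)%type (dim M1 + dim M2)) :=
  [set prod_chart cd.1 cd.2 | cd in @atlas _ M1 `*` @atlas _ M2].

Definition prod_chart_at (z : M1 * M2) :=
  prod_chart (chart_at z.1) (chart_at z.2).

Fact prod_chart_at_atlas z : prod_atlas (prod_chart_at z).
Proof.
by exists (chart_at z.1, chart_at z.2) => //; split; exact: chart_at_atlas.
Qed.

Fact prod_chart_at_dom z : chart_dom (prod_chart_at z) z.
Proof. by split; exact: chart_at_dom. Qed.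

Fact prod_atlas_compat c d : prod_atlas c -> prod_atlas d ->
  smooth_on (c @` (chart_dom c `&` chart_dom d)) (d \o chart_inv c).
Proof.
move=> [[c1 c2] [/= ac1 ac2] <-{c}] [[d1 d2] [/= ad1 ad2] <-{d}] k.
have := row_map_Ck (chart_overlap_open (c := c1) (chart_dom_open d1))
  (chart_overlap_open (c := c2) (chart_dom_open d2))
  (atlas_compat ac1 ad1 k) (atlas_compat ac2 ad2 k).
congr Ck; apply/seteqP; split=> x /=.
  move=> [[p [cp dp px]] [q [cq dq qx]]]; exists (p, q) => //.
  by rewrite /= px qx hsubmxK.
move=> [[p q] [[/= cp cq] [/= dp dq]] <-]; rewrite /row_set /= row_mxKl row_mxKr.
by split; [exists p|exists q].
Qed.

Definition prod_manifold : manifold R :=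
  Manifold prod_chart_at_atlas prod_chart_at_dom prod_atlas_compat
    (hausdorff_prod (@manifold_hausdorff _ M1) (@manifold_hausdorff _ M2))
    (second_countable_prod (@manifold_second_countable _ M1)
      (@manifold_second_countable _ M2)).
End ProdManifold.
End Product.

(* The warped product.  In what follows the component of u tangent to M_i at z
   is the image of u under the differential of the i-th projection. *)
Section WarpedProduct.
Context {R : realType} (M1 M2 : manifold R).
Let M := prod_manifold M1 M2.

Definition proj1 : M -> M1 := fst.
Definition proj2 : M -> M2 := snd.

Definition warped_metric (g1 : M1 -> 'M[R]_(dim M1)) (f : M1 -> R)
    (g2 : M2 -> 'M[R]_(dim M2)) (z : M) : 'M[R]_(dim M) :=
  pullback proj1 g1 z + f (proj1 z) ^+ 2 *: pullback proj2 g2 z.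

Definition tangent1 (X : M -> 'rV[R]_(dim M)) (z : M) : 'rV[R]_(dim M1) :=
  X z *m dmap proj1 z.
Definition tangent2 (X : M -> 'rV[R]_(dim M)) (z : M) : 'rV[R]_(dim M2) :=
  X z *m dmap proj2 z.

(* Lifts, pushed forward along the slices M1 x {q} and {p} x M2. *)
Definition slice1 (q : M2) : M1 -> M := fun p => (p, q).
Definition slice2 (p : M1) : M2 -> M := fun q => (p, q).

Definition lift1 (X1 : M1 -> 'rV[R]_(dim M1)) (z : M) : 'rV[R]_(dim M) :=
  X1 (proj1 z) *m dmap (slice1 (proj2 z)) (proj1 z).
Definition lift2 (X2 : M2 -> 'rV[R]_(dim M2)) (z : M) : 'rV[R]_(dim M) :=
  X2 (proj2 z) *m dmap (slice2 (proj1 z)) (proj2 z).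

End WarpedProduct.

(* Main.v *)
(* In a chart with coordinates x, a vector field xi and the Gram matrix A of a
   covariant 2-tensor T, the Lie derivative has Gram matrix
     D_xi A + (J xi) A + A (J xi)^T.
   Since this expression is covariant under transition maps (by the symmetry of
   second derivatives), it computes L_xi T in every chart and near every point,
   so L_xi T is again differentiable and can be differentiated once more.
   On the product, a tensor T + h B with T on M_1, B on M_2 and h a function on
   M_1 is block diagonal, and so is J zeta; hence
     L_zeta (T + h B) = L_zeta1 T + zeta1(h) B + h L_zeta2 B.
   Applying this twice, starting from g = g_1 + f^2 g_2, gives the formula. *)

Require Import Defs.
From HB Require Import structures.
From mathcomp Require Import all_boot all_order all_algebra.
From mathcomp Require Import all_classical all_reals all_analysis.
From mathcomp Require Import ring.
Set Implicit Arguments.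
Unset Strict Implicit.
Unset Printing Implicit Defensive.
Import Order.TTheory GRing.Theory Num.Theory.
Import numFieldNormedType.Exports.
Local Open Scope classical_set_scope.
Local Open Scope ring_scope.

Local Notation dim := Defs.dim.

(** * Matrix-valued differential calculus *)

Section MatrixCalculus.
Context {R : realType}.

Lemma near_eq_differentiable (V W : normedModType R) (f g : V -> W) x :
  {near x, f =1 g} -> differentiable g x -> differentiable f x.
Proof.
move=> fg; apply: near_differentiable.
by apply: filterS fg => y ->.
Qed.

Lemma row_jacobian n m (f : 'rV[R]_n -> 'rV[R]_m) x i :
  differentiable f x -> row i ('J f x) = 'D_(delta_mx 0 i) f x.
Proof. by move=> df; rewrite rowE (deriveEjacobian _ df). Qed.

Lemma near_eq_jacobian n m (f g : 'rV[R]_n -> 'rV[R]_m) x :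
  {near x, f =1 g} -> differentiable g x -> 'J f x = 'J g x.
Proof.
move=> fg dg; have df := near_eq_differentiable fg dg.
apply/row_matrixP => i.
apply: etrans (row_jacobian i df) (etrans _ (esym (row_jacobian i dg))).
exact: near_eq_derive.
Qed.

(** Entries are linear functions of the matrix; conversely a matrix is the finite sum of its entries
    times the basis matrices. This reduces the rules below to scalar functions. *)
Lemma differentiable_mxP (V : normedModType R) m n (M : V -> 'M[R]_(m, n)) x :
  differentiable M x <-> forall i j, differentiable (fun y => M y i j : R^o) x.
Proof.
split=> [dM i j|dM].
  apply: (differentiable_comp (g := fun N : 'M[R]_(m, n) => N i j : R^o)) => //.
  exact: differentiable_coord.
have -> : M = \sum_(i < m) \sum_(j < n) (fun y => M y i j *: delta_mx i j).
  apply/funext => y; rewrite fct_sumE [LHS]matrix_sum_delta.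
  by apply: eq_bigr => i _; rewrite fct_sumE.
apply: differentiable_sum => i; apply: differentiable_sum => j.
exact: differentiableZl.
Qed.

Lemma derive_entry (V : normedModType R) m n (M : V -> 'M[R]_(m, n)) x v i j :
  differentiable M x -> ('D_v M x) i j = 'D_v (fun y => M y i j : R^o) x.
Proof. by move=> dM; rewrite derive_mx ?mxE//; exact: diff_derivable. Qed.

Lemma mulmx_entry (V : normedModType R) m n p (A : V -> 'M[R]_(m, n))
    (B : V -> 'M[R]_(n, p)) i j :
  (fun y => (A y *m B y) i j : R^o) =
  \sum_k ((fun y => A y i k : R^o) * (fun y => B y k j : R^o)).
Proof. by apply/funext => y; rewrite mxE fct_sumE. Qed.

Lemma differentiable_mulmx (V : normedModType R) m n p (A : V -> 'M[R]_(m, n))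
    (B : V -> 'M[R]_(n, p)) x :
  differentiable A x -> differentiable B x ->
  differentiable (fun y => A y *m B y) x.
Proof.
move=> /differentiable_mxP dA /differentiable_mxP dB.
apply/differentiable_mxP => i j; rewrite mulmx_entry.
by apply: differentiable_sum => k; exact: differentiableM.
Qed.

Lemma derive_mulmx (V : normedModType R) m n p (A : V -> 'M[R]_(m, n))
    (B : V -> 'M[R]_(n, p)) x v :
  differentiable A x -> differentiable B x ->
  'D_v (fun y => A y *m B y) x = 'D_v A x *m B x + A x *m 'D_v B x.
Proof.
move=> dA dB; apply/matrixP => i j.
rewrite derive_entry; last exact: differentiable_mulmx.
move/differentiable_mxP: (dA) => dA'; move/differentiable_mxP: (dB) => dB'.
rewrite mulmx_entry derive_sum; last first.
  by move=> k; apply: derivableM; exact: diff_derivable.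
rewrite !mxE -big_split; apply: eq_bigr => k _ /=.
rewrite deriveM; [|exact: diff_derivable|exact: diff_derivable].
by rewrite !derive_entry// /GRing.scale/= addrC [B x k j * _]mulrC.
Qed.

Lemma differentiable_trmx (V : normedModType R) m n (A : V -> 'M[R]_(m, n)) x :
  differentiable A x -> differentiable (fun y => (A y)^T) x.
Proof.
move=> /differentiable_mxP dA; apply/differentiable_mxP => i j.
by under eq_fun do rewrite mxE; exact: dA.
Qed.

Lemma derive_trmx (V : normedModType R) m n (A : V -> 'M[R]_(m, n)) x v :
  differentiable A x -> 'D_v (fun y => (A y)^T) x = ('D_v A x)^T.
Proof.
move=> dA; apply/matrixP => i j.
rewrite mxE !derive_entry//; last exact: differentiable_trmx.
by under eq_fun do rewrite mxE.
Qed.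

Lemma derive_comp (U V W : normedModType R) (f : U -> V) (g : V -> W) x v :
  differentiable f x -> differentiable g (f x) ->
  'D_v (g \o f) x = 'D_('D_v f x) g (f x).
Proof.
move=> df dg; rewrite !deriveE//; last exact: differentiable_comp.
by rewrite diff_comp.
Qed.

(** Jacobians act on rows from the right, so the chain rule puts the inner Jacobian first. *)
Lemma jacobian_comp n m p (f : 'rV[R]_n -> 'rV[R]_m) (g : 'rV[R]_m -> 'rV[R]_p) x :
  differentiable f x -> differentiable g (f x) ->
  'J (g \o f) x = 'J f x *m 'J g (f x).
Proof.
move=> df dg; apply/row_matrixP => i; have dgf := differentiable_comp df dg.
apply: etrans (row_jacobian i dgf) _.
by rewrite row_mul (row_jacobian i df) -(deriveEjacobian _ dg) derive_comp.
Qed.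

Lemma jacobian_id n (x : 'rV[R]_n) : 'J id x = 1%:M.
Proof.
apply/row_matrixP => i; by rewrite row_jacobian ?derive_id ?rowE ?mulmx1//; exact: ex_diff.
Qed.

(** Separates the direction from the derivative: when [v] depends on the point, only the scalar
    coefficients vary while the directions stay fixed. *)
Lemma derive_delta n (W : normedModType R) (f : 'rV[R]_n -> W) x v :
  differentiable f x -> 'D_v f x = \sum_k v 0 k *: 'D_(delta_mx 0 k) f x.
Proof.
move=> df; rewrite deriveE// {1}(row_sum_delta v) linear_sum.
by apply: eq_bigr => k _; rewrite linearZ deriveE.
Qed.

End MatrixCalculus.

(** * Symmetry of second derivatives *)

Section Schwarz.
Context {R : realType}.

(** Restriction to a line, so that the one-variable mean value theorem applies. *)
Lemma is_derive_line (V W : normedModType R) (F : V -> W) (x u : V) (s : R) :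
  differentiable F (x + s *: u) ->
  is_derive s 1 (fun t : R => F (x + t *: u)) ('D_u F (x + s *: u)).
Proof.
move=> dF; pose g (t : R) := x + t *: u.
have dg : is_diff s g (fun t : R => 0 + t *: u).
  exact: (@is_diffD _ _ _ (cst x) (fun t : R => t *: u)).
have dg' : differentiable g s by exact: ex_diff.
have dFg : differentiable (F \o g) s by exact: differentiable_comp.
apply: DeriveDef; first exact: (diff_derivable dFg).
rewrite -/(F \o g) derive_comp//; congr ('D_(_) F _).
by rewrite deriveE// diff_val add0r scale1r.
Qed.

(* The mean value theorem, first along u and then along v.  The left-hand side
   is symmetric in u and v. *)
Lemma mixed_difference (V : normedModType R) (f : V -> R^o) (U : set V)
    (x u v : V) (h : R) : 0 < h ->
  (forall s t, 0 <= s <= h -> 0 <= t <= h -> U (x + s *: u + t *: v)) ->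
  (forall y, U y -> differentiable f y) ->
  (forall y, U y -> differentiable ('D_u f) y) ->
  exists s t, [/\ 0 <= s <= h, 0 <= t <= h &
    f (x + h *: u + h *: v) - f (x + h *: u) - f (x + h *: v) + f x =
    h ^+ 2 * 'D_v ('D_u f) (x + s *: u + t *: v)].
Proof.
move=> h0 hU df dDf.
have h0h : 0 <= h <= h by rewrite ltW/=.
have h00 : 0 <= (0 : R) <= h by rewrite lexx ltW.
have inI (t : R) : t \in `[0, h]%R -> 0 <= t <= h by rewrite in_itv.
(* The mixed difference is the increment over [0, h] of s |-> f(x + h v + s u) - f(x + s u). *)
have der (t : R) : 0 <= t <= h ->
    is_derive t 1 (fun s : R => f (x + h *: v + s *: u) - f (x + s *: u))
      ('D_u f (x + h *: v + t *: u) - 'D_u f (x + t *: u)).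
  move=> th; apply: is_deriveB; apply: is_derive_line; apply: df.
    by rewrite addrAC; exact: hU.
  by have := hU _ _ th h00; rewrite scale0r addr0.
have [|| s sh es] := @MVT_segment R
    (fun s : R => f (x + h *: v + s *: u) - f (x + s *: u))
    (fun t => 'D_u f (x + h *: v + t *: u) - 'D_u f (x + t *: u)) 0 h (ltW h0).
- by move=> t; rewrite in_itv/= => /andP[t0 th]; apply: der; rewrite !ltW.
- apply: derivable_within_continuous => t /inI /der dt.
  exact: ex_derive.
have {}sh := inI _ sh.
(* Second application, with the intermediate [s] fixed: the derivative just found is the increment
   of t |-> D_u f(x + s u + t v) over [0, h]. *)
have der2 (t : R) : 0 <= t <= h ->
    is_derive t 1 (fun t : R => 'D_u f (x + s *: u + t *: v) : R^o)
      ('D_v ('D_u f) (x + s *: u + t *: v)).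
  by move=> th; apply: is_derive_line; apply: dDf; exact: hU.
have [|| t th et] := @MVT_segment R
    (fun t : R => 'D_u f (x + s *: u + t *: v))
    (fun t => 'D_v ('D_u f) (x + s *: u + t *: v)) 0 h (ltW h0).
- by move=> t; rewrite in_itv/= => /andP[t0 th]; apply: der2; rewrite !ltW.
- apply: derivable_within_continuous => t /inI /der2 dt.
  exact: ex_derive.
have {}th := inI _ th; exists s, t; split => //.
rewrite !scale0r !addr0 subr0 in es et.
rewrite (addrAC x (h *: u)) expr2 mulrAC -mulrA [h * _]mulrC -et.
by rewrite (addrAC x (s *: u)) -es opprD opprK addrA.
Qed.

(** By the triangle inequality through [c]. Here [a] and [b] will be the two mixed derivatives at a
    point, and [c] a value close to both. *)
Lemma not_near_both (a b c : R) :
  `|a - c| < `|a - b| / 2 -> `|b - c| < `|a - b| / 2 -> False.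
Proof.
move=> ac bc; have := ltrD ac bc; rewrite -splitr (distrC b).
by move/(le_lt_trans (ler_distD c a b)); rewrite ltxx.
Qed.

(** If the two mixed derivatives differed at [x], continuity would keep each within half their
    distance of its value at [x] on a small ball. But the mixed difference over a small
    parallelogram is h^2 times a value of either one, so both take a common value in that ball. *)
Lemma schwarz_real (V : normedModType R) (f : V -> R^o) (U : set V)
    (x u v : V) : open U -> U x ->
  (forall y, U y -> differentiable f y) ->
  (forall y, U y -> differentiable ('D_u f) y) ->
  (forall y, U y -> differentiable ('D_v f) y) ->
  {for x, continuous ('D_u ('D_v f))} ->
  {for x, continuous ('D_v ('D_u f))} ->
  'D_u ('D_v f) x = 'D_v ('D_u f) x.
Proof.
move=> oU Ux df duf dvf cuv cvu; apply: contrapT => /eqP.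
rewrite -subr_eq0 -normr_gt0 => e0.
have e20 := divr_gt0 e0 (ltr0n R 2).
move/cvgrPdist_lt : cuv => /(_ _ e20) cuv.
move/cvgrPdist_lt : cvu => /(_ _ e20) cvu.
have nU : nbhs x U by exact: open_nbhs_nbhs.
have [r /= r0 hr] := (nbhs_ballP _ _).1 (filterI nU (filterI cuv cvu)).
(* The parallelogram with sides h u and h v must fit in the ball of radius [r]. The added 1 keeps
   the denominator positive when u = v = 0 and makes the bound strict. *)
pose h := r / (`|u| + `|v| + 1).
have k0 : 0 < `|u| + `|v| + 1 by rewrite ltr_wpDl// addr_ge0.
have h0 : 0 < h by rewrite divr_gt0.
(* Stated for general [a] and [b] in order to serve for both orders of the directions. *)
have hb s t a b : `|a| + `|b| = `|u| + `|v| -> 0 <= s <= h -> 0 <= t <= h ->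
    ball x r (x + s *: a + t *: b).
  move=> ab /andP[s0 sh] /andP[t0 th].
  rewrite -ball_normE /= -addrA opprD addrA subrr sub0r normrN.
  apply: le_lt_trans (ler_normD _ _) _; rewrite !normrZ !ger0_norm//.
  apply: (@le_lt_trans _ _ (h * (`|u| + `|v|))).
    by rewrite -ab mulrDr lerD// ler_wpM2r.
  by rewrite -mulrAC ltr_pdivrMr// ltr_pM2l// ltrDl.
have hbu s t := hb s t u v erefl; have hbv s t := hb s t v u (addrC _ _).
have [s [t [sh th E1]]] := mixed_difference h0
  (fun s t sh th => (hr _ (hbu s t sh th)).1) df duf.
have [s' [t' [sh' th' E2]]] := mixed_difference h0
  (fun s t sh th => (hr _ (hbv s t sh th)).1) df dvf.
have [_ [_ B1]] := hr _ (hbu _ _ sh th).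
have [_ [B2 _]] := hr _ (hbv _ _ sh' th').
have h20 : h ^+ 2 != 0 by rewrite expf_neq0// gt_eqF.
(* Both sides times h^2 equal the same mixed difference, which is symmetric in [u] and [v]. *)
have E3 : 'D_v ('D_u f) (x + s *: u + t *: v) =
    'D_u ('D_v f) (x + s' *: v + t' *: u).
  apply: (mulfI h20); apply: etrans (esym E1) (etrans _ E2).
  by rewrite (addrAC x (h *: v)); congr (_ + _); exact: addrAC.
rewrite /= E3 in B1.
exact: not_near_both B2 B1.
Qed.

(** The real case applied to each component. Taking a component commutes with differentiation only
    on [U], so second derivatives are compared through equality near each point of the open set. *)
Lemma schwarz n (V : normedModType R) (f : V -> 'rV[R]_n) (U : set V)
    (x u v : V) : open U -> U x -> Ck 2 U f ->
  'D_u ('D_v f) x = 'D_v ('D_u f) x.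
Proof.
move=> oU Ux [df Df].
have [duf Duf] := Df u; have [dvf Dvf] := Df v.
pose fj (j : 'I_n) : V -> R^o := fun y => f y 0 j.
have DE w j y : U y -> ('D_w f y) 0 j = 'D_w (fj j) y.
  by move=> Uy; rewrite derive_entry//; exact: df.
have nb y : U y -> nbhs y U by move=> Uy; exact: open_nbhs_nbhs.
have DEn w j y : U y ->
    {near y, (fun y => ('D_w f y) 0 j : R^o) =1 'D_w (fj j)}.
  by move=> /nb; apply: filterS => z; exact: DE.
have dD w j y : U y -> differentiable ('D_w f) y ->
    differentiable ('D_w (fj j)) y.
  move=> Uy /differentiable_mxP/(_ 0 j).
  by apply: near_differentiable; exact: DEn.
have DDE w w' j y : U y -> differentiable ('D_w f) y ->
    ('D_w' ('D_w f) y) 0 j = 'D_w' ('D_w (fj j)) y.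
  by move=> Uy dw; rewrite derive_entry//; apply: near_eq_derive; exact: DEn.
have cD w w' j : (forall y, U y -> differentiable ('D_w f) y) ->
    {for x, continuous ('D_w' ('D_w f))} ->
    {for x, continuous ('D_w' ('D_w (fj j)) : V -> R^o)}.
  move=> dw cw; rewrite /prop_for /continuous_at -DDE//; last exact: dw.
  have : (fun y => ('D_w' ('D_w f) y) 0 j : R^o) @ x --> ('D_w' ('D_w f) x) 0 j.
    apply: (@continuous_comp _ _ _ ('D_w' ('D_w f)) (fun N : 'rV[R]_n => N 0 j : R^o)) => //.
    exact: coord_continuous.
  apply: cvg_trans; apply: near_eq_cvg; apply: filterS (nb _ Ux) => y Uy.
  by rewrite DDE//; exact: dw.
apply/rowP => j.
have E1 := DDE v u j _ Ux (dvf _ Ux); have E2 := DDE u v j _ Ux (duf _ Ux).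
apply: etrans E1 (etrans _ (esym E2)).
apply: (schwarz_real oU Ux).
- by move=> y /df /differentiable_mxP; exact.
- by move=> y Uy; apply: dD => //; exact: duf.
- by move=> y Uy; apply: dD => //; exact: dvf.
- exact: cD dvf (Dvf u x Ux).
- exact: cD duf (Duf v x Ux).
Qed.
End Schwarz.

(** * The Lie derivative in coordinates *)

Section LocalLie.
Context {R : realType}.

(** Row i of ['J xi x] is d_i xi, so the (i, j) entry is the classical xi^k d_k A_ij + (d_i xi^k)
    A_kj + A_ik (d_j xi^k). *)
Definition local_lie n (xi : 'rV[R]_n -> 'rV[R]_n) (A : 'rV[R]_n -> 'M[R]_n)
    (x : 'rV[R]_n) : 'M[R]_n :=
  'D_(xi x) A x + 'J xi x *m A x + A x *m ('J xi x)^T.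

Lemma jacobian_differentiable n m (U : set 'rV[R]_n)
    (f : 'rV[R]_n -> 'rV[R]_m) x :
  open U -> U x -> Ck 2 U f -> differentiable (fun y => 'J f y) x.
Proof.
move=> oU Ux [df Df]; apply/differentiable_mxP => i j.
have [dD _] := Df (delta_mx 0 i).
have /differentiable_mxP/(_ 0 j) := dD x Ux.
apply: near_eq_differentiable; apply: filterS (open_nbhs_nbhs (conj oU Ux)).
by move=> y Uy; rewrite -(row_jacobian i (df y Uy)) [RHS]mxE.
Qed.

(* Turns the symmetry of second derivatives into
   u *m 'D_v (J f) = v *m 'D_u (J f). *)
Lemma mul_derive_jacobian n m (U : set 'rV[R]_n)
    (f : 'rV[R]_n -> 'rV[R]_m) x u v :
  open U -> U x -> Ck 2 U f ->
  u *m 'D_v (fun y => 'J f y) x = 'D_v ('D_u f) x.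
Proof.
move=> oU Ux Cf; have [df _] := Cf; have dJ := jacobian_differentiable oU Ux Cf.
have := derive_mulmx v (differentiable_cst (u : 'M[R]_(1, n)) x) dJ.
rewrite derive_cst mul0mx add0r => <-.
apply: near_eq_derive; apply: filterS (open_nbhs_nbhs (conj oU Ux)) => y Uy.
exact: esym (deriveEjacobian _ (df y Uy)).
Qed.

(** Coordinate expressions agree only on the image of a chart domain, hence the need for equality
    near [x] rather than everywhere. *)
Lemma local_lie_near n (xi eta : 'rV[R]_n -> 'rV[R]_n)
    (A B : 'rV[R]_n -> 'M[R]_n) x :
  differentiable eta x ->
  {near x, xi =1 eta} -> {near x, A =1 B} -> local_lie xi A x = local_lie eta B x.
Proof.
move=> de xe AB; rewrite /local_lie (near_eq_jacobian xe de).
by rewrite (near_eq_derive _ AB) (nbhs_singleton xe) (nbhs_singleton AB).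
Qed.

(** [K] stands for the derivative of the Jacobian [J] along xi. Substituting Jxi J = J Jeta - K
    cancels the two terms in which [K] comes from differentiating J B J^T. *)
Lemma lie_transition_algebra n (B D J Jxi Jeta K : 'M[R]_n) :
  Jxi *m J + K = J *m Jeta ->
  K *m B *m J^T + J *m D *m J^T + J *m B *m K^T
    + Jxi *m (J *m B *m J^T) + J *m B *m J^T *m Jxi^T =
  J *m (D + Jeta *m B + B *m Jeta^T) *m J^T.
Proof.
move=> /(canRL (addrK _)) JK.
have -> : Jxi *m (J *m B *m J^T) =
    J *m Jeta *m B *m J^T - K *m B *m J^T.
  by rewrite !mulmxA JK !mulmxBl.
have -> : J *m B *m J^T *m Jxi^T =
    J *m B *m Jeta^T *m J^T - J *m B *m K^T.
  by rewrite -!mulmxA -!trmx_mul JK linearB /= !mulmxBr.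
rewrite !mulmxDr !mulmxDl !mulmxA.
set a := K *m _ *m _; set c := J *m _ *m K^T.
(* The reordering puts each of the two [K] terms next to its opposite. *)
by rewrite !addrA (ACl (1*5*3*7*2*4*6)) /= subrr add0r subrr add0r.
Qed.

(** Covariance under a change of coordinates. Differentiating A = J B J^T along xi leaves
    derivatives of [J]; these cancel against the one produced by differentiating the relation xi J =
    eta \o phi. *)
Lemma local_lie_transition n (U : set 'rV[R]_n) (phi xi eta : 'rV[R]_n -> 'rV[R]_n)
    (A B : 'rV[R]_n -> 'M[R]_n) x :
  open U -> U x -> Ck 2 U phi ->
  differentiable xi x -> differentiable eta (phi x) ->
  differentiable B (phi x) ->
  {near x, forall y, xi y *m 'J phi y = eta (phi y)} ->
  {near x, forall y, A y = 'J phi y *m B (phi y) *m ('J phi y)^T} ->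
  local_lie xi A x = 'J phi x *m local_lie eta B (phi x) *m ('J phi x)^T.
Proof.
move=> oU Ux Cphi dxi deta dB xieta AB.
have [dphi _] := Cphi; have dphix := dphi x Ux.
have dJ := jacobian_differentiable oU Ux Cphi.
set v := xi x; set J := 'J phi x; pose K := 'D_v (fun y => 'J phi y) x.
have xix : v *m J = eta (phi x) := nbhs_singleton xieta.
have Ax : A x = J *m B (phi x) *m J^T := nbhs_singleton AB.
have dBphi : differentiable (B \o phi) x by exact: differentiable_comp.
have detaphi : differentiable (eta \o phi) x by exact: differentiable_comp.
(* Differentiate xi *m J phi = eta \o phi in the direction u; symmetry of the
   second derivatives of phi identifies xi *m 'D_u (J phi) with u *m K. *)
have JK : 'J xi x *m J + K = J *m 'J eta (phi x).
  apply/row_matrixP => i; set u := delta_mx 0 i : 'rV[R]_n.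
  have e1 : 'D_u (fun y => xi y *m 'J phi y) x = 'D_u (eta \o phi) x.
    exact: near_eq_derive.
  have e2 := derive_mulmx u dxi dJ.
  have e3 : v *m 'D_u (fun y => 'J phi y) x = u *m K.
    apply: etrans (mul_derive_jacobian _ _ oU Ux Cphi) _.
    apply: etrans (schwarz _ _ oU Ux Cphi) _.
    exact: esym (mul_derive_jacobian _ _ oU Ux Cphi).
  have e4 : 'D_u (eta \o phi) x = u *m J *m 'J eta (phi x).
    apply: etrans (derive_comp u dphix deta) _.
    apply: etrans (deriveEjacobian _ deta) _.
    by rewrite (deriveEjacobian u dphix).
  have := etrans (esym e2) (etrans e1 e4).
  rewrite e3 (deriveEjacobian u dxi) -/J.
  move: ('J xi x) ('J eta (phi x)) (K) (J) => Jx Je K' J' e5.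
  by rewrite !rowE mulmxDr !mulmxA.
(* Product rule for J B J^T. In the middle term the chain rule turns the direction [v] into v J =
   eta (phi x). *)
have DA : 'D_v A x = K *m B (phi x) *m J^T
    + J *m 'D_(eta (phi x)) B (phi x) *m J^T + J *m B (phi x) *m K^T.
  have -> : 'D_v A x = 'D_v (fun y => 'J phi y *m B (phi y) *m ('J phi y)^T) x.
    exact: near_eq_derive.
  have dJB := differentiable_mulmx dJ dBphi.
  apply: etrans (derive_mulmx v dJB (differentiable_trmx dJ)) _.
  rewrite (derive_trmx v dJ); congr (_ + _).
  have eB : 'D_v (B \o phi) x = 'D_(eta (phi x)) B (phi x).
    apply: etrans (derive_comp v dphix dB) _.
    by rewrite (deriveEjacobian v dphix) xix.
  have eJB := derive_mulmx v dJ dBphi; rewrite eB in eJB.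
  exact: etrans (congr1 (mulmxr J^T) eJB) (mulmxDl _ _ _).
rewrite /local_lie -/v DA Ax.
exact: lie_transition_algebra.
Qed.
End LocalLie.

(** * Change of charts *)

Section Charts.
Context {R : realType} {M : manifold R}.
Implicit Types (c d e : chart R M (dim M)) (p : M).

Lemma bval_row n (A C D : 'M[R]_n) i j :
  bval A (row i C) (row j D) = (C *m A *m D^T) i j.
Proof. by rewrite /bval -row_mul tr_row !mxE; apply: eq_bigr => k _; rewrite !mxE. Qed.

Lemma mul_congruence n (J K L A : 'M[R]_n) :
  J *m K = L -> J *m (K *m A *m K^T) *m J^T = L *m A *m L^T.
Proof. by move=> <-; rewrite trmx_mul !mulmxA. Qed.

Lemma near_chart_img c p : chart_dom c p -> nbhs (c p) (c @` chart_dom c).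
Proof.
move=> cp; apply: open_nbhs_nbhs; split; first exact: chart_img_open.
by exists p.
Qed.

Lemma near_overlap c d p : chart_dom c p -> chart_dom d p ->
  nbhs (c p) (c @` (chart_dom c `&` chart_dom d)).
Proof.
move=> cp dp; apply: open_nbhs_nbhs; split; last by exists p.
exact/chart_overlap_open/chart_dom_open.
Qed.

Lemma transition_diff c d p : atlas c -> atlas d ->
  chart_dom c p -> chart_dom d p -> differentiable (d \o chart_inv c) (c p).
Proof.
move=> ac ad cp dp; have [dcd _] := atlas_compat ac ad 1.
by apply: dcd; exists p.
Qed.

Lemma cjac_refl c p : chart_dom c p -> cjac c c p = 1%:M.
Proof.
move=> cp; apply: etrans (jacobian_id (c p)); apply: near_eq_jacobian; last first.
  by [].
by apply: filterS (near_chart_img cp) => _ [q cq <-] /=; rewrite chart_coordK.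
Qed.

(** The cocycle identity, from the chain rule: the two coordinate changes agree on the image of the
    overlap of [c] and [d], where the inner chart inverse cancels. *)
Lemma cjac_trans c d e p : atlas c -> atlas d -> atlas e ->
  chart_dom c p -> chart_dom d p -> chart_dom e p ->
  cjac c d p *m cjac d e p = cjac c e p.
Proof.
move=> ac ad ae cp dp ep.
have dcd := transition_diff ac ad cp dp.
have cpd : (d \o chart_inv c) (c p) = d p by rewrite /= chart_coordK.
have dde : differentiable (e \o chart_inv d) ((d \o chart_inv c) (c p)).
  by rewrite cpd; exact: transition_diff.
have -> : cjac d e p = 'J (e \o chart_inv d) ((d \o chart_inv c) (c p)).
  by rewrite cpd.
apply: etrans (esym (jacobian_comp dcd dde)) _.
apply: esym; apply: near_eq_jacobian; last exact: differentiable_comp.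
apply: filterS (near_overlap cp dp) => _ [q [cq dq] <-] /=.
by rewrite !chart_coordK.
Qed.

Lemma components_trans c d X p : atlas c -> atlas d ->
  chart_dom c p -> chart_dom d p ->
  components c X p *m cjac c d p = components d X p.
Proof.
move=> ac ad cp dp; rewrite /components -mulmxA cjac_trans//.
  exact: chart_at_atlas.
exact: chart_at_dom.
Qed.

Lemma components_chart_at X p : components (chart_at p) X p = X p.
Proof. by rewrite /components cjac_refl ?mulmx1//; exact: chart_at_dom. Qed.

(* Components of T in the chart c; meaningful on chart_dom c only. *)
Definition gram (T : M -> 'M[R]_(dim M)) c p : 'M[R]_(dim M) :=
  cjac c (chart_at p) p *m T p *m (cjac c (chart_at p) p)^T.

Lemma gram_trans c d T p : atlas c -> atlas d ->
  chart_dom c p -> chart_dom d p ->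
  cjac c d p *m gram T d p *m (cjac c d p)^T = gram T c p.
Proof.
move=> ac ad cp dp; apply: mul_congruence; apply: cjac_trans => //.
  exact: chart_at_atlas.
exact: chart_at_dom.
Qed.

Lemma gram_chart_at T p : gram T (chart_at p) p = T p.
Proof.
by rewrite /gram cjac_refl ?trmx1 ?mulmx1 ?mul1mx//; exact: chart_at_dom.
Qed.

Lemma teval_frame T c i j :
  teval T (frame c i) (frame c j) = fun p => gram T c p i j.
Proof. by apply/funext => p; rewrite /teval bval_row. Qed.

Lemma components_frame c i p : atlas c -> chart_dom c p ->
  components c (frame c i) p = row i 1%:M.
Proof.
move=> ac cp; rewrite /components /frame -row_mul cjac_trans ?cjac_refl//.
  exact: chart_at_atlas.
exact: chart_at_dom.
Qed.

(* In the frame of c the components of d_i are constant, so [X, d_i] = - d_i X. *)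
Lemma lie_derivative_chart_at X T p :
  let c := chart_at p in
  differentiable (components c X \o chart_inv c) (c p) ->
  differentiable (gram T c \o chart_inv c) (c p) ->
  lie_derivative X T p =
    local_lie (components c X \o chart_inv c) (gram T c \o chart_inv c) (c p).
Proof.
move=> c; set Xc := components c X \o _; set Tc := gram T c \o _ => dX dT.
have ac : atlas c := chart_at_atlas p.
have cp : chart_dom c p := chart_at_dom p.
have XcE : Xc (c p) = X p.
  by rewrite /Xc /= chart_coordK// components_chart_at.
have TcE : Tc (c p) = T p by rewrite /Tc /= chart_coordK// gram_chart_at.
have frE i : frame c i p = row i 1%:M by rewrite /frame cjac_refl.
have bracket i : lie_bracket X (frame c i) p = row i (- 'J Xc (c p)).
  rewrite /lie_bracket -/c -/Xc.
  have -> : 'D_(X p) (components c (frame c i) \o chart_inv c) (c p) = 0.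
    apply: etrans (derive_cst (row i 1%:M) (c p) (X p)).
    apply: near_eq_derive; apply: filterS (near_chart_img cp) => _ [q cq <-] /=.
    by rewrite chart_coordK// components_frame.
  rewrite sub0r (linearN (row i)); congr (- _).
  by apply: etrans _ (esym (row_jacobian i dX)); rewrite frE rowE mulmx1.
apply/matrixP => i j; rewrite [LHS]mxE /=.
rewrite /teval !bracket !frE !bval_row.
have -> : vderiv X (fun q => bval (T q) (frame c i q) (frame c j q)) p =
    ('D_(Xc (c p)) Tc (c p)) i j.
  rewrite XcE (derive_entry (X p) i j dT) /vderiv -/c.
  have -> // : (fun q => bval (T q) (frame c i q) (frame c j q)) \o chart_inv c
    = fun y => Tc y i j.
  by apply/funext => x; rewrite /= bval_row.
rewrite -TcE /local_lie; move: ('J Xc (c p)) ('D_(Xc (c p)) Tc (c p)) => J D.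
rewrite trmx1 mulmx1 mul1mx linearN mulNmx mulmxN.
have mN (A : 'M[R]_(dim M)) : (- A) i j = - A i j by rewrite mxE.
have mD (A B : 'M[R]_(dim M)) : (A + B) i j = A i j + B i j by rewrite mxE.
by rewrite !mN !opprK -!mD.
Qed.

(** A single Lie derivative needs only this much regularity, and it is what is established for
    L_zeta T before the second Lie derivative is taken. *)
Definition diff_tensor (T : M -> 'M[R]_(dim M)) := forall c p, atlas c ->
  chart_dom c p -> differentiable (gram T c \o chart_inv c) (c p).

Definition diff_fun (f : M -> R) := forall c p, atlas c ->
  chart_dom c p -> differentiable (f \o chart_inv c : _ -> R^o) (c p).

Lemma smooth_vfield_diff X c p : smooth_vfield X -> atlas c ->
  chart_dom c p -> differentiable (components c X \o chart_inv c) (c p).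
Proof. by move=> sX ac cp; have [+ _] := sX c ac 1; apply; exists p. Qed.

Lemma smooth_fun_diff f : smooth_fun f -> diff_fun f.
Proof. by move=> sf c p ac cp; have [+ _] := sf c ac 1; apply; exists p. Qed.

Lemma smooth_tensor_Ck T c i j k : smooth_tensor T -> atlas c ->
  Ck k (c @` chart_dom c)
    (fun x => (gram T c \o chart_inv c) x i j : R^o).
Proof. by move=> sT ac; have := sT c ac i j k; rewrite teval_frame. Qed.

Lemma smooth_tensor_diff T : smooth_tensor T -> diff_tensor T.
Proof.
move=> sT c p ac cp; apply/differentiable_mxP => i j.
by have [+ _] := smooth_tensor_Ck i j 1 sT ac; apply; exists p.
Qed.

(** [lie_derivative] is computed at each point in the preferred chart of that point, which may jump
    from point to point. Covariance moves the computation to one fixed chart, so that the result can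
    be differentiated there. *)
Lemma gram_lie_derivative X T c p : smooth_vfield X -> diff_tensor T ->
  atlas c -> chart_dom c p ->
  gram (lie_derivative X T) c p =
    local_lie (components c X \o chart_inv c) (gram T c \o chart_inv c) (c p).
Proof.
move=> sX dT ac cp; pose d := chart_at p.
have ad : atlas d := chart_at_atlas p.
have dp : chart_dom d p := chart_at_dom p.
have dX := smooth_vfield_diff sX ad dp; have dTd := dT d p ad dp.
have eD := etrans (gram_chart_at _ p) (lie_derivative_chart_at dX dTd).
apply: etrans (esym (gram_trans _ ac ad cp dp)) _.
rewrite -/d in eD; rewrite eD; apply: esym.
have cpd : (d \o chart_inv c) (c p) = d p by rewrite /= chart_coordK.
have dX' : differentiable (components d X \o chart_inv d)
  ((d \o chart_inv c) (c p)) by rewrite cpd.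
have dT' : differentiable (gram T d \o chart_inv d)
  ((d \o chart_inv c) (c p)) by rewrite cpd.
have nov := near_overlap cp dp.
(* This relation and the next hold on the image of the overlap, where the chart inverses cancel and
   the Jacobian is [cjac c d q]; they are then the transformation laws of components. *)
have Xtrans : {near c p, forall y, (components c X \o chart_inv c) y
    *m 'J (d \o chart_inv c) y
    = (components d X \o chart_inv d) ((d \o chart_inv c) y)}.
  apply: filterS nov => _ [q [cq dq] <-] /=.
  move: (chart_inv c (c q)) (chart_coordK cq) => _ ->.
  apply: etrans (components_trans X ac ad cq dq) _.
  exact: esym (congr1 (components d X) (chart_coordK dq)).
have Ttrans : {near c p, forall y, (gram T c \o chart_inv c) y =
    'J (d \o chart_inv c) y
    *m (gram T d \o chart_inv d) ((d \o chart_inv c) y)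
    *m ('J (d \o chart_inv c) y)^T}.
  apply: filterS nov => _ [q [cq dq] <-] /=.
  move: (chart_inv c (c q)) (chart_coordK cq) => _ ->.
  apply: etrans (esym (gram_trans T ac ad cq dq)) _.
  exact: esym (congr1 (fun r => cjac c d q *m gram T d r *m (cjac c d q)^T)
    (chart_coordK dq)).
have oU : open (c @` (chart_dom c `&` chart_dom d)).
  exact/chart_overlap_open/chart_dom_open.
have Up : (c @` (chart_dom c `&` chart_dom d)) (c p) by exists p.
have dXc := smooth_vfield_diff sX ac cp.
apply: etrans (local_lie_transition oU Up (atlas_compat ac ad 2) dXc dX' dT'
  Xtrans Ttrans) _.
exact: (congr1 (fun x => cjac c d p *m local_lie (components d X \o chart_inv d)
  (gram T d \o chart_inv d) x *m (cjac c d p)^T) cpd).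
Qed.
End Charts.

(** * Differentiability of Lie and directional derivatives *)

Section Regularity.
Context {R : realType}.

(** Near [x] the derivative along xi is the sum of xi^k d_k h, each factor of which is
    differentiable. *)
Lemma differentiable_derive_along n (U : set 'rV[R]_n) (h : 'rV[R]_n -> R^o)
    (xi : 'rV[R]_n -> 'rV[R]_n) x : open U -> U x -> Ck 2 U h ->
  differentiable xi x -> differentiable (fun y => 'D_(xi y) h y) x.
Proof.
move=> oU Ux [dh Dh] /differentiable_mxP dxi.
apply: (near_eq_differentiable (g := \sum_(k < n)
  ((fun y => xi y 0 k : R^o) * 'D_(delta_mx 0 k) h))).
  apply: filterS (open_nbhs_nbhs (conj oU Ux)) => y Uy.
  by rewrite fct_sumE; exact: derive_delta (dh y Uy).
apply: differentiable_sum => k; apply: differentiableM; first exact: dxi.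
by have [dhk _] := Dh (delta_mx 0 k); exact: dhk.
Qed.

(** The coordinate formula contains only first derivatives of [xi] and [A], so C^2 data leave one
    derivative to spare. *)
Lemma differentiable_local_lie n (U : set 'rV[R]_n)
    (xi : 'rV[R]_n -> 'rV[R]_n) (A : 'rV[R]_n -> 'M[R]_n) x :
  open U -> U x -> Ck 2 U xi ->
  (forall i j, Ck 2 U (fun y => A y i j : R^o)) ->
  differentiable (local_lie xi A) x.
Proof.
move=> oU Ux Cxi CA.
have dxi : differentiable xi x by case: Cxi => dxi _; exact: dxi.
have dA y : U y -> differentiable A y.
  by move=> Uy; apply/differentiable_mxP => i j; have [+ _] := CA i j; apply.
have dJ := jacobian_differentiable oU Ux Cxi.
apply: differentiableD; first apply: differentiableD.
- apply/differentiable_mxP => i j.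
  apply: near_eq_differentiable (differentiable_derive_along oU Ux (CA i j) dxi).
  apply: filterS (open_nbhs_nbhs (conj oU Ux)) => y Uy.
  exact: derive_entry (dA y Uy).
- exact: differentiable_mulmx dJ (dA x Ux).
- exact: differentiable_mulmx (dA x Ux) (differentiable_trmx dJ).
Qed.

Context {M : manifold R}.
Implicit Types (c d : chart R M (dim M)) (p : M) (f g : M -> R).

(** Makes the second Lie derivative accessible: on a whole chart domain the first one equals a
    single differentiable coordinate expression. *)
Lemma lie_derivative_diff X (T : M -> 'M[R]_(dim M)) : smooth_vfield X ->
  smooth_tensor T -> diff_tensor (lie_derivative X T).
Proof.
move=> sX sT c p ac cp.
have Up : (c @` chart_dom c) (c p) by exists p.
have dL := differentiable_local_lie (A := gram T c \o chart_inv c)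
  (@chart_img_open _ _ _ c) Up (sX c ac 2) (fun i j => smooth_tensor_Ck i j 2 sT ac).
apply: near_eq_differentiable dL.
apply: filterS (near_chart_img cp) => _ [q cq <-].
apply: etrans (congr1 (gram _ c) (chart_coordK cq)) _.
exact: gram_lie_derivative sX (smooth_tensor_diff sT) ac cq.
Qed.

(** Chart independence, by the chain rule: the Jacobian of the coordinate change carries [X p] to
    its components in [c]. *)
Lemma vderiv_chart X f c p : diff_fun f -> atlas c -> chart_dom c p ->
  vderiv X f p = 'D_(components c X p) (f \o chart_inv c : _ -> R^o) (c p).
Proof.
move=> df ac cp; pose d := chart_at p.
have ad : atlas d := chart_at_atlas p.
have dp : chart_dom d p := chart_at_dom p.
have ddc := transition_diff ad ac dp cp.
have dpc : (c \o chart_inv d) (d p) = c p by rewrite /= chart_coordK.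
have dfc : differentiable (f \o chart_inv c : _ -> R^o) ((c \o chart_inv d) (d p)).
  by rewrite dpc; exact: df.
have e1 : 'D_(X p) (f \o chart_inv d : _ -> R^o) (d p) =
    'D_(X p) ((f \o chart_inv c : _ -> R^o) \o (c \o chart_inv d)) (d p).
  apply: near_eq_derive; apply: filterS (near_overlap dp cp) => _ [q [dq cq] <-].
  by rewrite /= !chart_coordK.
apply: etrans e1 (etrans (derive_comp (X p) ddc dfc) _).
have e2 : 'D_(X p) (c \o chart_inv d) (d p) = components c X p.
  exact: deriveEjacobian.
apply: etrans (congr1 (fun v => 'D_v (f \o chart_inv c : _ -> R^o) _) e2) _.
by rewrite dpc.
Qed.

Lemma vderiv_diff X f : smooth_vfield X -> smooth_fun f -> diff_fun (vderiv X f).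
Proof.
move=> sX sf c p ac cp.
have Up : (c @` chart_dom c) (c p) by exists p.
apply: near_eq_differentiable (differentiable_derive_along (@chart_img_open _ _ _ c) Up
  (sf c ac 2) (smooth_vfield_diff sX ac cp)).
apply: filterS (near_chart_img cp) => _ [q cq <-].
apply: etrans (congr1 (vderiv X f) (chart_coordK cq)) _.
rewrite (vderiv_chart X (smooth_fun_diff sf) ac cq).
by rewrite [in RHS]/= (chart_coordK cq).
Qed.

Lemma diff_funD f g : diff_fun f -> diff_fun g -> diff_fun (fun p => f p + g p).
Proof.
move=> df dg c p ac cp.
exact: differentiableD (df c p ac cp) (dg c p ac cp).
Qed.

Lemma diff_funM f g : diff_fun f -> diff_fun g -> diff_fun (fun p => f p * g p).
Proof.
move=> df dg c p ac cp.
exact: differentiableM (df c p ac cp) (dg c p ac cp).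
Qed.

Lemma vderivD X f g p : diff_fun f -> diff_fun g ->
  vderiv X (fun q => f q + g q) p = vderiv X f p + vderiv X g p.
Proof.
move=> df dg; have cp := chart_at_dom p; have ac := chart_at_atlas p.
exact: deriveD (diff_derivable (df _ _ ac cp)) (diff_derivable (dg _ _ ac cp)).
Qed.

Lemma vderivM X f g p : diff_fun f -> diff_fun g ->
  vderiv X (fun q => f q * g q) p = vderiv X f p * g p + f p * vderiv X g p.
Proof.
move=> df dg; have cp := chart_at_dom p; have ac := chart_at_atlas p.
apply: etrans (deriveM (diff_derivable (df _ _ ac cp))
  (diff_derivable (dg _ _ ac cp))) _.
by rewrite /= chart_coordK// addrC [_ *: _]mulrC.
Qed.

End Regularity.

(** * Block-diagonal tensors in coordinates *)

Section BlockCalculus.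
Context {R : realType}.

Lemma differentiable_scalemx (V : normedModType R) m n (k : V -> R^o)
    (A : V -> 'M[R]_(m, n)) x :
  differentiable k x -> differentiable A x ->
  differentiable (fun y => k y *: A y) x.
Proof.
move=> dk /differentiable_mxP dA; apply/differentiable_mxP => i j.
under eq_fun do rewrite mxE.
exact: differentiableM dk (dA i j).
Qed.

Lemma derive_scalemx (V : normedModType R) m n (k : V -> R^o)
    (A : V -> 'M[R]_(m, n)) x v :
  differentiable k x -> differentiable A x ->
  'D_v (fun y => k y *: A y) x = 'D_v k x *: A x + k x *: 'D_v A x.
Proof.
move=> dk dA; apply/matrixP => i j.
apply: etrans (derive_entry v i j (differentiable_scalemx dk dA)) _.
have dAij := (differentiable_mxP A x).1 dA i j.
have -> : (fun y => (k y *: A y) i j : R^o) = k * (fun y => A y i j : R^o).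
  by apply/funext => y; rewrite mxE.
apply: etrans (deriveM (diff_derivable dk) (diff_derivable dAij)) _.
rewrite -(derive_entry v i j dA); move: ('D_v k x) ('D_v A x) => D E.
by rewrite !mxE addrC [_ *: D]mulrC.
Qed.

Lemma block_entries n1 n2 (P : ('I_(n1 + n2) -> 'I_(n1 + n2) -> Prop)) :
  (forall i j, P (lshift n2 i) (lshift n2 j)) ->
  (forall i j, P (lshift n2 i) (rshift n1 j)) ->
  (forall i j, P (rshift n1 i) (lshift n2 j)) ->
  (forall i j, P (rshift n1 i) (rshift n1 j)) -> forall i j, P i j.
Proof.
move=> Pul Pur Pdl Pdr i j.
by case: (split_ordP i) => i' ->; case: (split_ordP j) => j' ->.
Qed.

Lemma differentiable_block (V : normedModType R) n1 n2 (A : V -> 'M[R]_n1)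
    (B : V -> 'M[R]_n2) x :
  differentiable A x -> differentiable B x ->
  differentiable (fun y => block_mx (A y) 0 0 (B y)) x.
Proof.
move=> /differentiable_mxP dA /differentiable_mxP dB.
apply/differentiable_mxP; apply: block_entries => i j.
- by under eq_fun do rewrite block_mxEul; exact: dA.
- by under eq_fun do rewrite block_mxEur mxE; exact: differentiable_cst.
- by under eq_fun do rewrite block_mxEdl mxE; exact: differentiable_cst.
- by under eq_fun do rewrite block_mxEdr; exact: dB.
Qed.

Lemma derive_block (V : normedModType R) n1 n2 (A : V -> 'M[R]_n1)
    (B : V -> 'M[R]_n2) x v :
  differentiable A x -> differentiable B x ->
  'D_v (fun y => block_mx (A y) 0 0 (B y)) x = block_mx ('D_v A x) 0 0 ('D_v B x).
Proof.
move=> dA dB; apply/matrixP => i j.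
apply: etrans (derive_entry v i j (differentiable_block dA dB)) _.
move: i j; apply: block_entries => i j.
- rewrite block_mxEul; apply: etrans _ (esym (derive_entry v i j dA)).
  by congr ('D_v _ x); apply/funext => y; rewrite block_mxEul.
- rewrite block_mxEur mxE; apply: etrans _ (derive_cst (0 : R^o) x v).
  by congr ('D_v _ x); apply/funext => y; rewrite block_mxEur mxE.
- rewrite block_mxEdl mxE; apply: etrans _ (derive_cst (0 : R^o) x v).
  by congr ('D_v _ x); apply/funext => y; rewrite block_mxEdl mxE.
- rewrite block_mxEdr; apply: etrans _ (esym (derive_entry v i j dB)).
  by congr ('D_v _ x); apply/funext => y; rewrite block_mxEdr.
Qed.

Lemma row_ext m n (A B : 'M[R]_(m, n)) :
  (forall u : 'rV_m, u *m A = u *m B) -> A = B.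
Proof. by move=> AB; apply/row_matrixP => i; rewrite !rowE. Qed.

Section Sub.
Variables (n1 n2 : nat) (W : normedModType R) (x v : 'rV[R]_(n1 + n2)).

Lemma derive_lsubmx : 'D_v (lsubmx : _ -> 'rV[R]_n1) x = lsubmx v.
Proof.
apply: etrans (deriveE v (differentiable_lsubmx x)) _.
by have -> := diff_lin x (@continuous_lsubmx R 1 n1 n2).
Qed.

Lemma derive_rsubmx : 'D_v (rsubmx : _ -> 'rV[R]_n2) x = rsubmx v.
Proof.
apply: etrans (deriveE v (differentiable_rsubmx x)) _.
by have -> := diff_lin x (@continuous_rsubmx R 1 n1 n2).
Qed.

Lemma derive_comp_lsubmx (F : 'rV[R]_n1 -> W) : differentiable F (lsubmx x) ->
  'D_v (F \o lsubmx) x = 'D_(lsubmx v) F (lsubmx x).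
Proof.
move=> dF; apply: etrans (derive_comp v (differentiable_lsubmx x) dF) _.
exact: (congr1 (fun w => 'D_w F (lsubmx x)) derive_lsubmx).
Qed.

Lemma derive_comp_rsubmx (F : 'rV[R]_n2 -> W) : differentiable F (rsubmx x) ->
  'D_v (F \o rsubmx) x = 'D_(rsubmx v) F (rsubmx x).
Proof.
move=> dF; apply: etrans (derive_comp v (differentiable_rsubmx x) dF) _.
exact: (congr1 (fun w => 'D_w F (rsubmx x)) derive_rsubmx).
Qed.
End Sub.

Lemma jacobian_row_map n1 n2 m1 m2 (f : 'rV[R]_n1 -> 'rV[R]_m1)
    (g : 'rV[R]_n2 -> 'rV[R]_m2) x :
  differentiable f (lsubmx x) -> differentiable g (rsubmx x) ->
  'J (row_map f g) x = block_mx ('J f (lsubmx x)) 0 0 ('J g (rsubmx x)).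
Proof.
move=> df dg; apply: row_ext => u.
have [dr Dr] := row_map_diff df dg.
apply: etrans (esym (deriveEjacobian u dr)) (etrans (Dr u) _).
apply: etrans (congr2 row_mx (deriveEjacobian _ df) (deriveEjacobian _ dg)) _.
move: ('J f _) ('J g _) => Jf Jg.
by rewrite -[in RHS](hsubmxK u) mul_row_block !mulmx0 addr0 add0r.
Qed.

(** The Jacobian of the field is block diagonal, so no mixed block appears. The scalars depend on
    the first variable alone and are differentiated along [xi1]; [B] and [C] depend on the second
    alone and are differentiated along [xi2]. *)
Lemma local_lie_block n1 n2 (xi1 : 'rV[R]_n1 -> 'rV[R]_n1)
    (xi2 : 'rV[R]_n2 -> 'rV[R]_n2) (A : 'rV[R]_n1 -> 'M[R]_n1)
    (h k : 'rV[R]_n1 -> R^o) (B C : 'rV[R]_n2 -> 'M[R]_n2)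
    (x : 'rV[R]_(n1 + n2)) :
  let x1 := lsubmx x in let x2 := rsubmx x in
  differentiable xi1 x1 -> differentiable xi2 x2 -> differentiable A x1 ->
  differentiable h x1 -> differentiable k x1 ->
  differentiable B x2 -> differentiable C x2 ->
  let S y := block_mx (A (lsubmx y)) 0 0
    (h (lsubmx y) *: B (rsubmx y) + k (lsubmx y) *: C (rsubmx y)) in
  differentiable S x /\
  local_lie (row_map xi1 xi2) S x =
    block_mx (local_lie xi1 A x1) 0 0
      ('D_(xi1 x1) h x1 *: B x2 + h x1 *: local_lie xi2 B x2
       + ('D_(xi1 x1) k x1 *: C x2 + k x1 *: local_lie xi2 C x2)).
Proof.
move=> x1 x2 dxi1 dxi2 dA dh dk dB dC S.
have dl : differentiable (lsubmx : 'rV[R]_(n1 + n2) -> 'rV[R]_n1) x.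
  exact: differentiable_lsubmx.
have dr : differentiable (rsubmx : 'rV[R]_(n1 + n2) -> 'rV[R]_n2) x.
  exact: differentiable_rsubmx.
have dAl := differentiable_comp dl dA.
have dhl := differentiable_comp dl dh; have dkl := differentiable_comp dl dk.
have dBr := differentiable_comp dr dB; have dCr := differentiable_comp dr dC.
have dhB := differentiable_scalemx dhl dBr.
have dkC := differentiable_scalemx dkl dCr.
have dS := differentiable_block dAl (differentiableD dhB dkC).
split; first exact: dS.
set v := row_map xi1 xi2 x.
have lv : lsubmx v = xi1 x1 by rewrite /v row_mxKl.
have rv : rsubmx v = xi2 x2 by rewrite /v row_mxKr.
have DA : 'D_v (A \o lsubmx) x = 'D_(xi1 x1) A x1.
  by rewrite -lv; exact: derive_comp_lsubmx.
have DhB : 'D_v (fun y => (h \o lsubmx) y *: (B \o rsubmx) y) x =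
    'D_(xi1 x1) h x1 *: B x2 + h x1 *: 'D_(xi2 x2) B x2.
  apply: etrans (derive_scalemx v dhl dBr) _.
  exact: (congr2 (fun a D => a *: B x2 + h x1 *: D)
    (etrans (derive_comp_lsubmx v dh) (congr1 (fun w => 'D_w h x1) lv))
    (etrans (derive_comp_rsubmx v dB) (congr1 (fun w => 'D_w B x2) rv))).
have DkC : 'D_v (fun y => (k \o lsubmx) y *: (C \o rsubmx) y) x =
    'D_(xi1 x1) k x1 *: C x2 + k x1 *: 'D_(xi2 x2) C x2.
  apply: etrans (derive_scalemx v dkl dCr) _.
  exact: (congr2 (fun a D => a *: C x2 + k x1 *: D)
    (etrans (derive_comp_lsubmx v dk) (congr1 (fun w => 'D_w k x1) lv))
    (etrans (derive_comp_rsubmx v dC) (congr1 (fun w => 'D_w C x2) rv))).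
have DS : 'D_v S x = block_mx ('D_(xi1 x1) A x1) 0 0
    ('D_(xi1 x1) h x1 *: B x2 + h x1 *: 'D_(xi2 x2) B x2 +
     ('D_(xi1 x1) k x1 *: C x2 + k x1 *: 'D_(xi2 x2) C x2)).
  apply: etrans (derive_block v dAl (differentiableD dhB dkC)) _.
  have D2 := etrans (deriveD (diff_derivable dhB) (diff_derivable dkC))
    (congr2 +%R DhB DkC).
  exact: (congr2 (fun D E => block_mx D 0 0 E) DA D2).
rewrite /local_lie -/v DS (jacobian_row_map dxi1 dxi2) /S -/x1 -/x2.
move: ('J xi1 x1) ('J xi2 x2) ('D_(xi1 x1) A x1) ('D_(xi1 x1) h x1) => J1 J2 DA1 Dh.
move: ('D_(xi1 x1) k x1) ('D_(xi2 x2) B x2) ('D_(xi2 x2) C x2) => Dk DB DC.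
move: (A x1) (B x2) (C x2) (h x1) (k x1) => A1 B2 C2 a b {DS DkC DhB DA}.
rewrite tr_block_mx !trmx0 !mulmx_block !mulmx0 !mul0mx !addr0 !add0r.
rewrite !add_block_mx !addr0; congr block_mx.
rewrite !scalerDr !mulmxDr !mulmxDl -!scalemxAr -!scalemxAl !addrA.
(* Collects the terms of [B] before those of [C], each group led by the derivative of its scalar. *)
by rewrite (ACl (1*2*5*7*3*4*6*8)).
Qed.
End BlockCalculus.

(** * Product manifolds *)

Section ProductManifold.
Context {R : realType} {M1 M2 : manifold R}.
Let M := prod_manifold M1 M2.

Lemma near_row_set n1 n2 (x : 'rV[R]_(n1 + n2)) (U1 : set 'rV[R]_n1)
    (U2 : set 'rV[R]_n2) : nbhs (lsubmx x) U1 -> nbhs (rsubmx x) U2 ->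
  nbhs x (row_set U1 U2).
Proof.
move=> n1U n2U; apply: (@filterI _ _ _ (lsubmx @^-1` U1) (rsubmx @^-1` U2)).
  exact: continuous_lsubmx n1U.
exact: continuous_rsubmx n2U.
Qed.

(** Points near (c1 p, c2 q) are coordinates of points of both chart domains, so a local identity
    may be checked where the chart inverses cancel. *)
Lemma near_prod_chart (c1 : chart R M1 (dim M1)) (c2 : chart R M2 (dim M2))
    (p : M1) (q : M2) (P : 'rV[R]_(dim M1 + dim M2) -> Prop) :
  chart_dom c1 p -> chart_dom c2 q ->
  (forall p' q', chart_dom c1 p' -> chart_dom c2 q' ->
    P (row_mx (c1 p') (c2 q'))) ->
  nbhs (row_mx (c1 p) (c2 q)) P.
Proof.
move=> cp cq HP; apply: filterS (@near_row_set _ _ _ (c1 @` chart_dom c1)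
  (c2 @` chart_dom c2) _ _); last 2 first.
- by rewrite row_mxKl; exact: near_chart_img.
- by rewrite row_mxKr; exact: near_chart_img.
move=> x [[p' cp' ep] [q' cq' eq]]; rewrite -(hsubmxK x) -ep -eq.
exact: HP.
Qed.

(** In the product of preferred charts the projection reads as the linear map [lsubmx], which is its
    own differential. *)
Lemma dmap_proj1 (z : M) : dmap (@proj1 R M1 M2) z = col_mx 1%:M 0.
Proof.
case: z => p q; rewrite /dmap.
have cp : chart_dom (chart_at p) p := chart_at_dom p.
have cq : chart_dom (chart_at q) q := chart_at_dom q.
apply: row_ext => u.
have dl : differentiable (lsubmx : 'rV[R]_(dim M1 + dim M2) -> 'rV[R]_(dim M1))
  (row_mx (chart_at p p) (chart_at q q)) by exact: differentiable_lsubmx.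
have e : {near row_mx (chart_at p p) (chart_at q q),
    (chart_at p \o @proj1 R M1 M2 \o chart_inv (prod_chart_at (p, q)) :
      'rV[R]_(dim M1 + dim M2) -> 'rV[R]_(dim M1)) =1 lsubmx}.
  apply: near_prod_chart => // p' q' cp' cq'.
  by rewrite /= row_mxKl chart_coordK.
apply: etrans (congr1 (mulmx u) (near_eq_jacobian e dl)) _.
apply: etrans (esym (deriveEjacobian u dl)) _.
apply: etrans (derive_lsubmx _ u) _.
by rewrite -[in RHS](hsubmxK u) mul_row_col mulmx1 mulmx0 addr0.
Qed.

Lemma dmap_proj2 (z : M) : dmap (@proj2 R M1 M2) z = col_mx 0 1%:M.
Proof.
case: z => p q; rewrite /dmap.
have cp : chart_dom (chart_at p) p := chart_at_dom p.
have cq : chart_dom (chart_at q) q := chart_at_dom q.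
apply: row_ext => u.
have dr : differentiable (rsubmx : 'rV[R]_(dim M1 + dim M2) -> 'rV[R]_(dim M2))
  (row_mx (chart_at p p) (chart_at q q)) by exact: differentiable_rsubmx.
have e : {near row_mx (chart_at p p) (chart_at q q),
    (chart_at q \o @proj2 R M1 M2 \o chart_inv (prod_chart_at (p, q)) :
      'rV[R]_(dim M1 + dim M2) -> 'rV[R]_(dim M2)) =1 rsubmx}.
  apply: near_prod_chart => // p' q' cp' cq'.
  by rewrite /= row_mxKr chart_coordK.
apply: etrans (congr1 (mulmx u) (near_eq_jacobian e dr)) _.
apply: etrans (esym (deriveEjacobian u dr)) _.
apply: etrans (derive_rsubmx _ u) _.
by rewrite -[in RHS](hsubmxK u) mul_row_col mulmx1 mulmx0 add0r.
Qed.

(** In the preferred charts the slice is affine: the linear map [rowl] plus the constant row [a]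
    holding the coordinates of [q]. *)
Lemma dmap_slice1 (p : M1) (q : M2) :
  dmap (@slice1 R M1 M2 q) p = row_mx 1%:M 0.
Proof.
have cp : chart_dom (chart_at p) p := chart_at_dom p.
pose a : 'rV[R]_(dim M1 + dim M2) := row_mx 0 (chart_at q q).
pose L : 'rV[R]_(dim M1) -> 'rV[R]_(dim M1 + dim M2) := @rowl R _ _.
have dL : differentiable L (chart_at p p).
  exact/linear_differentiable/rowl_continuous.
have dLa : differentiable (L + cst a) (chart_at p p) by exact: differentiableD.
apply: row_ext => u.
have e : {near chart_at p p,
    (chart_at (slice1 q p) \o slice1 q \o chart_inv (chart_at p) :
      'rV[R]_(dim M1) -> 'rV[R]_(dim M1 + dim M2)) =1 (L + cst a)}.
  apply: filterS (near_chart_img cp) => _ [p' cp' <-].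
  rewrite /= chart_coordK//; apply: esym; apply: etrans (add_row_mx _ _ _ _) _.
  by rewrite addr0 add0r.
apply: etrans (congr1 (mulmx u) (near_eq_jacobian e dLa)) _.
apply: etrans (esym (deriveEjacobian u dLa)) _.
apply: etrans (deriveD (diff_derivable dL) (derivable_cst _ _ _)) _.
rewrite derive_cst addr0; apply: etrans (deriveE u dL) _.
have -> := diff_lin (chart_at p p) (@rowl_continuous R (dim M1) (dim M2)).
by rewrite /rowl mul_mx_row mulmx1 mulmx0.
Qed.

Lemma dmap_slice2 (p : M1) (q : M2) :
  dmap (@slice2 R M1 M2 p) q = row_mx 0 1%:M.
Proof.
have cq : chart_dom (chart_at q) q := chart_at_dom q.
pose a : 'rV[R]_(dim M1 + dim M2) := row_mx (chart_at p p) 0.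
pose L : 'rV[R]_(dim M2) -> 'rV[R]_(dim M1 + dim M2) := @rowr R _ _.
have dL : differentiable L (chart_at q q).
  exact/linear_differentiable/rowr_continuous.
have dLa : differentiable (L + cst a) (chart_at q q) by exact: differentiableD.
apply: row_ext => u.
have e : {near chart_at q q,
    (chart_at (slice2 p q) \o slice2 p \o chart_inv (chart_at q) :
      'rV[R]_(dim M2) -> 'rV[R]_(dim M1 + dim M2)) =1 (L + cst a)}.
  apply: filterS (near_chart_img cq) => _ [q' cq' <-].
  rewrite /= chart_coordK//; apply: esym; apply: etrans (add_row_mx _ _ _ _) _.
  by rewrite addr0 add0r.
apply: etrans (congr1 (mulmx u) (near_eq_jacobian e dLa)) _.
apply: etrans (esym (deriveEjacobian u dLa)) _.
apply: etrans (deriveD (diff_derivable dL) (derivable_cst _ _ _)) _.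
rewrite derive_cst addr0; apply: etrans (deriveE u dL) _.
have -> := diff_lin (chart_at q q) (@rowr_continuous R (dim M1) (dim M2)).
by rewrite /rowr mul_mx_row mulmx1 mulmx0.
Qed.

Lemma liftD (X1 : M1 -> 'rV[R]_(dim M1)) (X2 : M2 -> 'rV[R]_(dim M2)) (z : M) :
  lift1 X1 z + lift2 X2 z = row_mx (X1 z.1) (X2 z.2).
Proof.
rewrite /lift1 /lift2 dmap_slice1 dmap_slice2 !mul_mx_row !mulmx0 !mulmx1.
by apply: etrans (add_row_mx _ _ _ _) _; rewrite addr0 add0r.
Qed.

Lemma warped_metricE (g1 : M1 -> 'M[R]_(dim M1)) (f : M1 -> R)
    (g2 : M2 -> 'M[R]_(dim M2)) (z : M) :
  warped_metric g1 f g2 z = block_mx (g1 z.1) 0 0 (f z.1 ^+ 2 *: g2 z.2).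
Proof.
rewrite /warped_metric /pullback dmap_proj1 dmap_proj2 /proj1 /proj2.
move: (g1 z.1) (g2 z.2) (f z.1 ^+ 2) => A B a.
rewrite !tr_col_mx !trmx1 !trmx0 !mul_col_mx !mul1mx !mul0mx !mul_mx_row.
rewrite !mulmx1 !mulmx0.
rewrite /block_mx scale_col_mx !scale_row_mx !scaler0.
by apply: etrans (add_col_mx _ _ _ _) _; rewrite addr0 add0r.
Qed.

Lemma teval_block (S : M -> 'M[R]_(dim M)) (X Y : M -> 'rV[R]_(dim M))
    (A : 'M[R]_(dim M1)) (B : 'M[R]_(dim M2)) (z : M) :
  S z = block_mx A 0 0 B ->
  teval S X Y z =
    bval A (tangent1 X z) (tangent1 Y z) + bval B (tangent2 X z) (tangent2 Y z).
Proof.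
rewrite /teval => ->; rewrite /tangent1 /tangent2 dmap_proj1 dmap_proj2.
move: (X z) (Y z) => u v; rewrite /bval.
rewrite -(hsubmxK u) -(hsubmxK v) mul_row_block !mulmx0 addr0 add0r.
rewrite tr_row_mx mul_row_col !mul_row_col !mulmx0 !mulmx1 addr0 add0r.
by rewrite addr0 add0r [LHS]mxE.
Qed.

(** A change of product charts is the [row_map] of the changes on the factors. *)
Lemma cjac_prod (c1 d1 : chart R M1 (dim M1)) (c2 d2 : chart R M2 (dim M2))
    (p : M1) (q : M2) :
  atlas c1 -> atlas d1 -> atlas c2 -> atlas d2 ->
  chart_dom c1 p -> chart_dom d1 p -> chart_dom c2 q -> chart_dom d2 q ->
  @cjac R M (prod_chart c1 c2) (prod_chart d1 d2) (p, q) =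
    block_mx (cjac c1 d1 p) 0 0 (cjac c2 d2 q).
Proof.
move=> ac1 ad1 ac2 ad2 cp dp cq dq.
have d1d := transition_diff ac1 ad1 cp dp.
have d2d := transition_diff ac2 ad2 cq dq.
pose x : 'rV[R]_(dim M1 + dim M2) := row_mx (c1 p) (c2 q).
have xl : lsubmx x = c1 p by rewrite row_mxKl.
have xr : rsubmx x = c2 q by rewrite row_mxKr.
have d1l : differentiable (d1 \o chart_inv c1) (lsubmx x) by rewrite xl.
have d2r : differentiable (d2 \o chart_inv c2) (rsubmx x) by rewrite xr.
apply: etrans (jacobian_row_map d1l d2r) _.
exact: (congr2 (fun a b => block_mx ('J (d1 \o chart_inv c1) a) 0 0
  ('J (d2 \o chart_inv c2) b)) xl xr).
Qed.
End ProductManifold.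

Lemma bvalD (R : realType) n (A B : 'M[R]_n) u v :
  bval (A + B) u v = bval A u v + bval B u v.
Proof. by rewrite /bval mulmxDr mulmxDl mxE. Qed.

Lemma bvalZ (R : realType) n (a : R) (A : 'M[R]_n) u v :
  bval (a *: A) u v = a * bval A u v.
Proof. by rewrite /bval -scalemxAr -scalemxAl mxE. Qed.

(** * Lie derivatives of block tensors on the product *)

Section ProductLieDerivative.
Context {R : realType} {M1 M2 : manifold R}.
Let M := prod_manifold M1 M2.

(* Two terms h B and k C are needed because L_zeta g already has the M_2 part
   zeta1(f^2) g_2 + f^2 L_zeta2 g_2. *)
Lemma lie_derivative_prod (zeta : M -> 'rV[R]_(dim M))
    (X1 : M1 -> 'rV[R]_(dim M1)) (X2 : M2 -> 'rV[R]_(dim M2))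
    (S : M -> 'M[R]_(dim M)) (T : M1 -> 'M[R]_(dim M1)) (h k : M1 -> R)
    (B C : M2 -> 'M[R]_(dim M2)) :
  (forall z, zeta z = row_mx (X1 z.1) (X2 z.2)) ->
  smooth_vfield X1 -> smooth_vfield X2 ->
  (forall z, S z =
    block_mx (T z.1) 0 0 (h z.1 *: B z.2 + k z.1 *: C z.2)) ->
  diff_tensor T -> diff_fun h -> diff_fun k -> diff_tensor B -> diff_tensor C ->
  forall z, lie_derivative zeta S z =
    block_mx (lie_derivative X1 T z.1) 0 0
      (vderiv X1 h z.1 *: B z.2 + h z.1 *: lie_derivative X2 B z.2
       + (vderiv X1 k z.1 *: C z.2 + k z.1 *: lie_derivative X2 C z.2)).
Proof.
move=> zetaE sX1 sX2 SE dT dh dk dB dC [p q] /=.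
pose c1 := chart_at p; pose c2 := chart_at q.
pose c : chart R M (dim M) := prod_chart c1 c2.
have ac1 : atlas c1 := chart_at_atlas p.
have ac2 : atlas c2 := chart_at_atlas q.
have cp : chart_dom c1 p := chart_at_dom p.
have cq : chart_dom c2 q := chart_at_dom q.
pose x : 'rV[R]_(dim M1 + dim M2) := row_mx (c1 p) (c2 q).
pose xi1 := components c1 X1 \o chart_inv c1.
pose xi2 := components c2 X2 \o chart_inv c2.
pose T' := gram T c1 \o chart_inv c1.
pose B' := gram B c2 \o chart_inv c2.
pose C' := gram C c2 \o chart_inv c2.
pose h' : _ -> R^o := h \o chart_inv c1.
pose k' : _ -> R^o := k \o chart_inv c1.
pose S' (y : 'rV[R]_(dim M1 + dim M2)) := block_mx (T' (lsubmx y)) 0 0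
  (h' (lsubmx y) *: B' (rsubmx y) + k' (lsubmx y) *: C' (rsubmx y)).
have xl : lsubmx x = c1 p by rewrite row_mxKl.
have xr : rsubmx x = c2 q by rewrite row_mxKr.
have dxi1 : differentiable xi1 (lsubmx x).
  by rewrite xl; exact: smooth_vfield_diff.
have dxi2 : differentiable xi2 (rsubmx x).
  by rewrite xr; exact: smooth_vfield_diff.
have dT' : differentiable T' (lsubmx x) by rewrite xl; exact: dT.
have dB' : differentiable B' (rsubmx x) by rewrite xr; exact: dB.
have dC' : differentiable C' (rsubmx x) by rewrite xr; exact: dC.
have dh' : differentiable h' (lsubmx x) by rewrite xl; exact: dh.
have dk' : differentiable k' (lsubmx x) by rewrite xl; exact: dk.
have [dS' lieS'] := local_lie_block dxi1 dxi2 dT' dh' dk' dB' dC'.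
have [dxi _] := row_map_diff dxi1 dxi2.
(* The passage from the preferred charts to [c] is block diagonal, so it transforms the components
   of [X1] and [X2] separately. *)
have nxi : {near x, components c zeta \o chart_inv c =1 row_map xi1 xi2}.
  apply: near_prod_chart => // p' q' cp' cq'.
  have -> : (components c zeta \o chart_inv c) (row_mx (c1 p') (c2 q')) =
      components c zeta (p', q').
    exact: (congr1 (components c zeta)
      (chart_coordK (c := c) (conj cp' cq' : chart_dom c (p', q')))).
  rewrite /components zetaE /= (cjac_prod (chart_at_atlas p') ac1
    (chart_at_atlas q') ac2 (chart_at_dom p') cp' (chart_at_dom q') cq').
  rewrite mul_row_block !mulmx0 addr0 add0r /row_map row_mxKl row_mxKr.
  by rewrite /xi1 /xi2 /= (chart_coordK cp') (chart_coordK cq').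
(* Congruence by a block-diagonal Jacobian keeps the block form and commutes with the scalars. *)
have nS : {near x, gram S c \o chart_inv c =1 S'}.
  apply: near_prod_chart => // p' q' cp' cq'.
  have -> : (gram S c \o chart_inv c) (row_mx (c1 p') (c2 q')) =
      gram S c (p', q').
    exact: (congr1 (gram S c)
      (chart_coordK (c := c) (conj cp' cq' : chart_dom c (p', q')))).
  have e := cjac_prod ac1 (chart_at_atlas p') ac2 (chart_at_atlas q')
    cp' (chart_at_dom p') cq' (chart_at_dom q').
  apply: etrans (congr2 (fun J A => J *m A *m J^T) e (SE (p', q'))) _.
  rewrite /S' row_mxKl row_mxKr /T' /B' /C' /h' /k' /=.
  rewrite (chart_coordK cp') (chart_coordK cq') /gram.
  move: (cjac c1 (chart_at p') p') (cjac c2 (chart_at q') q') => J1 J2.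
  rewrite tr_block_mx !trmx0 !mulmx_block !mulmx0 !mul0mx !addr0 !add0r.
  by rewrite !mul0mx mulmxDr mulmxDl -!scalemxAr -!scalemxAl.
have dzc := near_eq_differentiable nxi dxi.
have dSc := near_eq_differentiable nS dS'.
(* The local formula is read back on the factors: [c1] and [c2] are preferred charts at [p] and [q],
   where Gram matrices and components are the tensors and fields themselves. *)
apply: etrans (@lie_derivative_chart_at R M zeta S (p, q) dzc dSc) _.
apply: etrans (local_lie_near dxi nxi nS) _.
apply: etrans lieS' _; rewrite xl xr.
have lT := lie_derivative_chart_at (smooth_vfield_diff sX1 ac1 cp) (dT _ _ ac1 cp).
have lB := lie_derivative_chart_at (smooth_vfield_diff sX2 ac2 cq) (dB _ _ ac2 cq).
have lC := lie_derivative_chart_at (smooth_vfield_diff sX2 ac2 cq) (dC _ _ ac2 cq).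
rewrite /xi1 /xi2 /T' /B' /C' /h' /k' -/c1 -/c2 in lT lB lC *.
rewrite -lT -lB -lC /= (chart_coordK cp) (chart_coordK cq).
by rewrite !gram_chart_at components_chart_at.
Qed.
End ProductLieDerivative.

(** * The twofold Lie derivative of the warped metric *)

Theorem theorem3 (R : realType) (M1 M2 : manifold R)
    (g1 : metric M1) (g2 : metric M2) (f : M1 -> R)
    (f_smooth : smooth_fun f) (f_pos : forall p, 0 < f p)
    (zeta1 : vfield M1) (zeta2 : vfield M2)
    (zeta : vfield (prod_manifold M1 M2))
    (zeta_sum : forall z, zeta z = lift1 zeta1 z + lift2 zeta2 z)
    (X Y : vfield (prod_manifold M1 M2)) (z : prod_manifold M1 M2) :
  let g := warped_metric g1 f g2 in
  let p := proj1 z in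
  let q := proj2 z in
  let X1 := tangent1 X z in
  let Y1 := tangent1 Y z in
  let X2 := tangent2 X z in
  let Y2 := tangent2 Y z in
  let L := @lie_derivative R (prod_manifold M1 M2) zeta in
  let L1 := @lie_derivative R M1 zeta1 in
  let L2 := @lie_derivative R M2 zeta2 in
  let zeta1f := vderiv zeta1 f in
  teval (L (L g)) X Y z =
    bval (L1 (L1 g1) p) X1 Y1
    + f p ^+ 2 * bval (L2 (L2 g2) q) X2 Y2
    + 4 * f p * zeta1f p * bval (L2 g2 q) X2 Y2
    + 2 * f p * vderiv zeta1 zeta1f p * bval (g2 q) X2 Y2
    + 2 * zeta1f p * zeta1f p * bval (g2 q) X2 Y2.
Proof.
move=> g p q X1 Y1 X2 Y2 L L1 L2 zeta1f.
have zetaE w : zeta w = row_mx (zeta1 w.1) (zeta2 w.2).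
  by rewrite zeta_sum liftD.
have sz1 := vfield_smooth zeta1; have sz2 := vfield_smooth zeta2.
have sg1 := metric_smooth g1; have sg2 := metric_smooth g2.
have df := smooth_fun_diff f_smooth.
have dzf : diff_fun zeta1f by exact: vderiv_diff.
have d0 : diff_fun (fun _ : M1 => 0).
  by move=> c r _ _; exact: differentiable_cst.
(* [h] is f^2 written as a product, ready for the Leibniz rule, and [h'] is zeta1(f^2). *)
pose h r := f r * f r; pose h' r := zeta1f r * f r + f r * zeta1f r.
have dh : diff_fun h by exact: diff_funM.
have dh' : diff_fun h' by apply: diff_funD; exact: diff_funM.
have hE r : vderiv zeta1 h r = h' r by exact: vderivM.
have h'E r : vderiv zeta1 h' r = vderiv zeta1 zeta1f r * f r
    + zeta1f r * zeta1f r + (zeta1f r * zeta1f r + f r * vderiv zeta1 zeta1f r).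
  rewrite /h' vderivD; [|exact: diff_funM..].
  by congr (_ + _); exact: vderivM.
have d2 := smooth_tensor_diff sg2.
(* For the first application the second term is [g2] with coefficient zero, whose derivative
   vanishes. *)
have gE w : g w = block_mx (g1 w.1) 0 0 (h w.1 *: g2 w.2 + 0 *: g2 w.2).
  by rewrite /g warped_metricE expr2 scale0r addr0.
have LgE w : L g w = block_mx (L1 g1 w.1) 0 0
    (h' w.1 *: g2 w.2 + h w.1 *: L2 g2 w.2).
  rewrite /L (lie_derivative_prod zetaE sz1 sz2 gE (smooth_tensor_diff sg1)
    dh d0 d2 d2) hE.
  have -> : vderiv zeta1 (fun=> 0) w.1 = 0.
    exact: (derive_cst (0 : R^o)).
  by rewrite !scale0r !addr0.
(* The second application uses the two terms h' g_2 and h L_zeta2 g_2. Each contributes h' L_zeta2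
   g_2, giving the coefficient 2 h' = 4 f zeta1(f), while zeta1(h') supplies the two terms in
   g_2. *)
have LLgE := lie_derivative_prod zetaE sz1 sz2 LgE
  (lie_derivative_diff sz1 sg1) dh' dh d2 (lie_derivative_diff sz2 sg2) z.
rewrite (teval_block X Y LLgE) hE h'E /h' /h !bvalD !bvalZ -/X1 -/Y1 -/X2 -/Y2.
rewrite -/p -/q -/L1 -/L2.
move: (bval _ X1 Y1) (bval (g2 q) X2 Y2) (bval (L2 g2 q) X2 Y2)
  (bval (L2 (L2 g2) q) X2 Y2) (vderiv zeta1 zeta1f p) (zeta1f p) (f p).
by move=> a b c d f2 f1 f0; ring.
Qed.
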